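(* Let $\lambda>-1$. Let $\Sigma$ be a rotational $\lambda$-translator with speed $\vec{v}=(0,0,1)$, parametrized by $\Psi(s,t)=(x(s)\cos t,x(s)\sin t,z(s))$ with arc-length generating curve $\gamma(s)=(x(s),0,z(s))$. Suppose that $\gamma$, with angle function $\theta$, satisfies $$x'(s)=\cos\theta(s),\qquad z'(s)=\sin\theta(s),\qquad \theta'(s)=x(s)\frac{\cos\theta(s)}{\sin\theta(s)}+\lambda\frac{x(s)}{\sin\theta(s)},$$ with initial conditions $x(0)=z(0)=\theta(0)=0$. Let $[0,\omega)$ be the maximal domain of $\gamma$. Up to a symmetry about the plane $z=0$ (i.e. up to replacing $(x,z,\theta)$ by $(x,-z,-\theta)$), the following holds. (1) If $\lambda>0$, then $\omega<\infty$ and $\gamma$ intersects the $z$-axis at $s=\omega$. This intersection is not orthogonal. Moreover, $x(s)<\sqrt{2}$ for all $s\in[0,\omega)$. (2) If $\lambda=0$, then $\omega=\infty$. The curve $\gamma$ is asymptotic to the vertical line of equation $x=\sqrt{2}$. The function $z=z(s)$ is strictly increasing with $\lim_{s\to\infty}z(s)=\infty$. (3) If $\lambda\in(-1,0)$, then $\omega=\infty$. The curve $\gamma$ (together with its reflection across the $z$-axis) is an entire graph on $\mathbb{R}$, where $\lim_{s\to\infty}x(s)=\lim_{s\to\infty}z(s)=\infty$ and $\lim_{s\to\infty}\theta(s)=\cos^{-1}(-\lambda)$. In all cases, the surface is convex.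
   Context: An oriented surface in $\mathbb{R}^3$ with unit normal $N$ and Gauss curvature $K$ is a $\lambda$-translator with speed $\vec{v}$ ($|\vec{v}|=1$, $\lambda\in\mathbb{R}$) if $K=\langle N,\vec{v}\rangle+\lambda$ at every point. The generating curve lies in the half-plane $x>0$, i.e. $x(s)>0$ for $s\in(0,\omega)$, and the maximal domain is understood under this requirement; ''$\gamma$ intersects the $z$-axis at $s=\omega$'' means $x(s)\to0$ as $s\to\omega^-$, and the intersection is orthogonal if $\sin\theta(s)\to0$ there. The third equation is singular at $s=0$: a solution is a triple of functions that is $C^1$ on $[0,\omega)$, satisfies the system for $s>0$ (with $\sin\theta(s)\ne 0$ for $s\in(0,\omega)$) and has the given initial values; $\theta(0)=0$ means that $\gamma$ meets the rotation axis orthogonally at $s=0$. The curve is an entire graph on $\mathbb{R}$ if it is of the form $z=u(x)$ with $u$ defined for all $x\in\mathbb{R}$ (all $x\geq0$ for $\gamma$ itself). The surface is convex if its generating curve is convex, i.e. the curvature $\theta'$ of $\gamma$ does not vanish (has constant sign). *)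

(* Defs.v *)
From Stdlib Require Import Reals.
From Coquelicot Require Import Coquelicot.

Open Scope R_scope.

Definition R3 : Type := (R * R * R)%type.

Definition mk3 (a b c : R) : R3 := (a, b, c).
Definition coord1 (p : R3) : R := fst (fst p).
Definition coord2 (p : R3) : R := snd (fst p).
Definition coord3 (p : R3) : R := snd p.

Definition dot (p q : R3) : R := coord1 p * coord1 q + coord2 p * coord2 q + coord3 p * coord3 q.

Definition cross (p q : R3) : R3 :=
  mk3 (coord2 p * coord3 q - coord3 p * coord2 q)
      (coord3 p * coord1 q - coord1 p * coord3 q)
      (coord1 p * coord2 q - coord2 p * coord1 q).

Definition scale3 (a : R) (p : R3) : R3 := mk3 (a * coord1 p) (a * coord2 p) (a * coord3 p).

Definition Derive3 (c : R -> R3) (a : R) : R3 :=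
  mk3 (Derive (fun u => coord1 (c u)) a)
      (Derive (fun u => coord2 (c u)) a)
      (Derive (fun u => coord3 (c u)) a).

(* [Derive] is total; the notions below are meaningful where the
   parametrization is twice differentiable and [first_form_det] is nonzero. *)
Definition diff_s (P : R -> R -> R3) (s t : R) : R3 := Derive3 (fun u => P u t) s.
Definition diff_t (P : R -> R -> R3) (s t : R) : R3 := Derive3 (fun u => P s u) t.

Definition unit_normal (P : R -> R -> R3) (s t : R) : R3 :=
  let W := cross (diff_s P s t) (diff_t P s t) in
  scale3 (/ sqrt (dot W W)) W.

Definition first_form_det (P : R -> R -> R3) (s t : R) : R :=
  dot (diff_s P s t) (diff_s P s t) * dot (diff_t P s t) (diff_t P s t)
  - dot (diff_s P s t) (diff_t P s t) ^ 2.

Definition second_form_det (P : R -> R -> R3) (s t : R) : R :=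
  let N := unit_normal P s t in
  dot N (diff_s (diff_s P) s t) * dot N (diff_t (diff_t P) s t)
  - dot N (diff_t (diff_s P) s t) ^ 2.

Definition gauss_curvature (P : R -> R -> R3) (s t : R) : R :=
  second_form_det P s t / first_form_det P s t.

(* The orientation is the one induced by the parametrization. *)
Definition lambda_translator (lambda : R) (v : R3) (D : R -> R -> Prop)
    (P : R -> R -> R3) : Prop :=
  forall s t : R, D s t ->
    0 < first_form_det P s t /\
    gauss_curvature P s t = dot (unit_normal P s t) v + lambda.

Definition rotational_surface (x z : R -> R) (s t : R) : R3 :=
  mk3 (x s * cos t) (x s * sin t) (z s).

(* The interval [0, omega), where omega may be infinite. *)
Definition dom (omega : Rbar) (s : R) : Prop := 0 <= s /\ Rbar_lt s omega.

(* Derivatives are taken within D, hence one-sided at an endpoint in D. *)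
Definition C1_on (D : R -> Prop) (f : R -> R) : Prop :=
  exists d : R -> R, forall s : R, D s -> D_in f d D s /\ continue_in d D s.

(* The values of x, z, theta outside [0, omega) are irrelevant. *)
Record is_solution (lambda : R) (omega : Rbar) (x z theta : R -> R) : Prop := {
  sol_C1_x : C1_on (dom omega) x;
  sol_C1_z : C1_on (dom omega) z;
  sol_C1_theta : C1_on (dom omega) theta;
  sol_x0 : x 0 = 0;
  sol_z0 : z 0 = 0;
  sol_theta0 : theta 0 = 0;
  sol_x_pos : forall s : R, 0 < s -> Rbar_lt s omega -> 0 < x s;
  sol_sin_neq0 : forall s : R, 0 < s -> Rbar_lt s omega -> sin (theta s) <> 0;
  sol_x : forall s : R, 0 < s -> Rbar_lt s omega -> is_derive x s (cos (theta s));
  sol_z : forall s : R, 0 < s -> Rbar_lt s omega -> is_derive z s (sin (theta s));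
  sol_theta : forall s : R, 0 < s -> Rbar_lt s omega ->
    is_derive theta s
      (x s * (cos (theta s) / sin (theta s)) + lambda * (x s / sin (theta s)))
}.

Definition is_maximal_solution (lambda : R) (omega : Rbar)
    (x z theta : R -> R) : Prop :=
  Rbar_lt 0 omega /\
  is_solution lambda omega x z theta /\
  ~ (exists (omega' : Rbar) (x' z' theta' : R -> R),
       Rbar_lt omega omega' /\
       is_solution lambda omega' x' z' theta' /\
       forall s : R, dom omega s ->
         x' s = x s /\ z' s = z s /\ theta' s = theta s).

Definition meets_z_axis_at (x : R -> R) (w : R) : Prop :=
  filterlim x (at_left w) (locally 0).

Definition orthogonal_at (theta : R -> R) (w : R) : Prop :=
  filterlim (fun s => sin (theta s)) (at_left w) (locally 0).

(* The curve goes to infinity while its distance to the line x = a tends to 0. *)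
Definition asymptotic_to_vertical_line (x z : R -> R) (a : R) : Prop :=
  is_lim x p_infty a /\ is_lim (fun s => Rabs (z s)) p_infty p_infty.

(* The curve s >= 0 |-> (x s, z s), together with its reflection across the
   z-axis, is the graph of a function defined on all of R. *)
Definition entire_graph (x z : R -> R) : Prop :=
  exists u : R -> R, forall a b : R,
    b = u a <-> exists s : R, 0 <= s /\ (a = x s \/ a = - x s) /\ b = z s.

(* The curvature of an arc-length curve with angle function theta is theta'. *)
Definition convex_curve (omega : Rbar) (theta : R -> R) : Prop :=
  exists kappa : R -> R,
    (forall s : R, dom omega s -> D_in theta kappa (dom omega) s) /\
    ((forall s : R, dom omega s -> 0 < kappa s) \/
     (forall s : R, dom omega s -> kappa s < 0)).

Definition up_to_reflection (Q : (R -> R) -> (R -> R) -> Prop)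
    (z theta : R -> R) : Prop :=
  Q z theta \/ Q (fun s => - z s) (fun s => - theta s).

(* Main.v *)
Require Import Defs.
From Stdlib Require Import Reals Lra.
From Coquelicot Require Import Coquelicot.

(** Write [u = cos theta + lambda].  The system gives [x' = u - lambda] and
    [u' = - x u], so [(x, x')] runs through a planar phase portrait with the first
    integral [G (x') + x^2 / 2], where [G p = p - lambda ln (p + lambda)] ([potential],
    [energy]).

    After a reflection [sin theta > 0] on the whole open interval.  The linear
    equation [u' = - x u] together with [x s <= s] yields
    [u s >= (1 + lambda) exp (- s^2 / 2)] ([cos_plus_lambda_bound]); hence
    [theta' = x u / sin theta] is positive and [theta] increases inside [(0, PI)].  At
    [s = 0] the formula for [theta'] is [0 / 0], and the positivity of [theta' 0] comes
    from [1 - cos theta >= k s^2 / 2] near [0] ([initial_slope]).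

    On a finite interval [[0, w)] the monotone bounded [theta] has a limit [Theta], and
    by the energy [x] is the function [radius lambda theta] of the angle alone, so it
    converges too.  The case [Theta = PI] would force [lambda > 1] and [G (-1) <= G 1],
    while [G (-1) > G 1] then ([potential_minus_one]).  If the limit of [x] were
    positive, the curve could be continued: in terms of the angle the system is the
    scalar autonomous equation [theta' = F theta] with [F > 0], solved through [w] by
    inverting a primitive of [1 / F] ([autonomous_ode_through], [solution_extends]).
    So a maximal curve of finite length ends on the axis, at an angle strictly between
    [0] and [PI] ([maximal_endpoint]).

    For [lambda > 0] the orbit turns back: [x' = u - lambda] cannot stay nonnegative,
    and once negative it drives [x] to [0] in finite time ([lifetime_finite]); the bound
    [sqrt 2] holds because the minimum [G 0] of [G] satisfies [G 1 - G 0 < 1].  For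
    [lambda <= 0] one has [x' = cos theta > 0], so [x] cannot return to [0] and the
    length is infinite ([lifetime_infinite]); then [(1 / u)' = x / u] is bounded below
    and [u] tends to [0] ([cos_theta_limit]), which determines the asymptotics of
    [theta], and of [x] when [lambda = 0]; the rest is linear growth. *)

Open Scope R_scope.

(** * Monotonicity, growth and limits of real functions *)

Lemma nondecreasing_interior (f df : R -> R) (omega : Rbar)
    (Hd : forall s, 0 < s -> Rbar_lt s omega -> is_derive f s (df s))
    (Hpos : forall s, 0 < s -> Rbar_lt s omega -> 0 <= df s) (a b : R) :
  0 < a -> a <= b -> Rbar_lt b omega -> f a <= f b.
Proof.
  intros Ha [Hab | ->] Hb; [ | lra].
  assert (Hin : forall c, a <= c <= b -> 0 < c /\ Rbar_lt c omega).
  { intros c Hc; split; [lra | apply (Rbar_le_lt_trans _ b); [apply Hc | exact Hb]]. }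
  destruct (MVT_cor2 f df a b Hab) as [c [Hc Hcab]].
  { intros c Hc; apply is_derive_Reals; apply Hd; apply Hin; exact Hc. }
  assert (0 <= df c) by (apply Hpos; apply Hin; lra).
  nra.
Qed.

(** At the initial point only one-sided information is available, so the mean value
    theorem is applied on the interior and the left end is reached as a limit.  The
    right end may be infinite, whence [Rbar]. *)
Lemma nondecreasing_from_start (f df : R -> R) (omega : Rbar)
    (H0 : filterlim f (at_right 0) (locally (f 0)))
    (Hd : forall s, 0 < s -> Rbar_lt s omega -> is_derive f s (df s))
    (Hpos : forall s, 0 < s -> Rbar_lt s omega -> 0 <= df s) (a b : R) :
  0 <= a -> a <= b -> Rbar_lt b omega -> f a <= f b.
Proof.
  intros [Ha | <-] Hab Hb; [now apply (nondecreasing_interior f df omega) | ].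
  destruct Hab as [Hb0 | <-]; [ | lra].
  apply (filterlim_le (F := at_right 0) f (fun _ => f b) (f 0) (f b)).
  - exists (mkposreal b Hb0); intros y Hy Hy0.
    apply Rabs_lt_between' in Hy; simpl in Hy.
    apply (nondecreasing_interior f df omega); trivial; lra.
  - exact H0.
  - apply filterlim_const.
Qed.

Lemma increasing_from_start (f df : R -> R) (omega : Rbar)
    (H0 : filterlim f (at_right 0) (locally (f 0)))
    (Hd : forall s, 0 < s -> Rbar_lt s omega -> is_derive f s (df s))
    (Hpos : forall s, 0 < s -> Rbar_lt s omega -> 0 < df s) (a b : R) :
  0 <= a -> a < b -> Rbar_lt b omega -> f a < f b.
Proof.
  intros Ha Hab Hb.
  assert (Hin : forall c, (a + b) / 2 <= c <= b -> 0 < c /\ Rbar_lt c omega).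
  { intros c Hc; split; [lra | apply (Rbar_le_lt_trans _ b); [apply Hc | exact Hb]]. }
  apply Rle_lt_trans with (f ((a + b) / 2)).
  - apply (nondecreasing_from_start f df omega); trivial; try lra.
    + intros; now apply Rlt_le, Hpos.
    + apply Hin; lra.
  - destruct (MVT_cor2 f df ((a + b) / 2) b) as [c [Hc Hcab]]; [lra | | ].
    { intros c Hc; apply is_derive_Reals; apply Hd; apply Hin; exact Hc. }
    assert (0 < df c) by (apply Hpos; apply Hin; lra).
    nra.
Qed.

Lemma constant_from_start (f : R -> R) (omega : Rbar)
    (H0 : filterlim f (at_right 0) (locally (f 0)))
    (Hd : forall s, 0 < s -> Rbar_lt s omega -> is_derive f s 0) (s : R) :
  0 <= s -> Rbar_lt s omega -> f s = f 0.
Proof.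
  intros Hs Hso; apply Rle_antisym.
  - enough (- f 0 <= - f s) by lra.
    apply (nondecreasing_from_start (fun t => - f t) (fun _ => 0) omega); trivial; try lra.
    + apply (filterlim_comp _ _ _ f Ropp _ _ _ H0).
      apply (filterlim_opp (f 0)).
    + intros t Ht Hto; rewrite <- Ropp_0.
      apply (is_derive_opp f t 0); auto.
    + intros; lra.
  - apply (nondecreasing_from_start f (fun _ => 0) omega); trivial; try lra; intros; lra.
Qed.

Lemma growth_linear (f df : R -> R) (k s0 : R)
    (Hd : forall s, s0 <= s -> is_derive f s (df s))
    (Hk : forall s, s0 <= s -> k <= df s) (s : R) :
  s0 <= s -> f s0 + k * (s - s0) <= f s.
Proof.
  intros [Hs | ->]; [ | lra].
  destruct (MVT_cor2 f df s0 s Hs) as [c [Hc Hcs]].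
  - intros c Hc; apply is_derive_Reals, Hd; lra.
  - pose proof (Hk c ltac:(lra)); nra.
Qed.

Lemma growth_to_infinity (f df : R -> R) (k s0 : R) (Hk0 : 0 < k)
    (Hd : forall s, s0 <= s -> is_derive f s (df s))
    (Hk : forall s, s0 <= s -> k <= df s) :
  is_lim f p_infty p_infty.
Proof.
  apply is_lim_spec; intros M.
  exists (Rmax s0 (s0 + (M - f s0) / k)); intros s Hs.
  pose proof (Rmax_l s0 (s0 + (M - f s0) / k)).
  pose proof (Rmax_r s0 (s0 + (M - f s0) / k)).
  apply Rlt_le_trans with (2 := growth_linear f df k s0 Hd Hk s ltac:(lra)).
  enough (M - f s0 < k * (s - s0)) by lra.
  apply Rmult_lt_reg_l with (/ k); [now apply Rinv_0_lt_compat | ].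
  rewrite <- Rmult_assoc, Rinv_l by lra.
  unfold Rdiv in *; lra.
Qed.

(** The intermediate value theorem, in the form that propagates a sign from one point
    [a] to the whole open interval. *)
Lemma nonvanishing_constant_sign (f : R -> R) (omega : Rbar)
    (Hc : forall s, 0 < s -> Rbar_lt s omega -> continuous f s)
    (Hn : forall s, 0 < s -> Rbar_lt s omega -> f s <> 0) (a : R) :
  0 < a -> Rbar_lt a omega -> 0 < f a ->
  forall s, 0 < s -> Rbar_lt s omega -> 0 < f s.
Proof.
  intros Ha Hao Hfa s Hs Hso.
  destruct (Rlt_le_dec 0 (f s)) as [Hp | Hp]; [exact Hp | exfalso].
  assert (Hneg : f s < 0) by (specialize (Hn s Hs Hso); lra).
  assert (Hin : forall c, Rmin a s <= c <= Rmax a s -> 0 < c /\ Rbar_lt c omega).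
  { intros c [Hc1 Hc2]; split.
    - apply Rlt_le_trans with (Rmin a s); [now apply Rmin_glb_lt | exact Hc1].
    - apply (Rbar_le_lt_trans _ (Rmax a s)); [exact Hc2 | ].
      unfold Rmax; destruct (Rle_dec a s); assumption. }
  assert (Hz : exists c, Rmin a s <= c <= Rmax a s /\ f c = 0).
  { destruct (Rtotal_order a s) as [Has | [-> | Has]]; [ | lra | ].
    - rewrite Rmin_left, Rmax_right in * by lra.
      destruct (Ranalysis5.IVT_interv (fun t => - f t) a s) as [c [Hc1 Hc2]]; try lra.
      + intros t Ht; apply continuity_pt_opp, continuity_pt_filterlim.
        now apply Hc; apply Hin.
      + exists c; split; [exact Hc1 | lra].
    - rewrite Rmin_right, Rmax_left in * by lra.
      destruct (Ranalysis5.IVT_interv f s a) as [c [Hc1 Hc2]]; try lra.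
      + intros t Ht; apply continuity_pt_filterlim.
        now apply Hc; apply Hin.
      + exists c; split; [exact Hc1 | lra]. }
  destruct Hz as [c [Hc1 Hc2]]; apply (Hn c); trivial; now apply Hin.
Qed.

Lemma monotone_limit_left (f : R -> R) (w M : R) (Hw : 0 < w)
    (Hf : forall a b, 0 < a -> a <= b -> b < w -> f a <= f b)
    (HM : forall s, 0 < s < w -> f s <= M) :
  exists l, l <= M /\ (forall s, 0 < s < w -> f s <= l) /\
    filterlim f (at_left w) (locally l).
Proof.
  destruct (completeness (fun y => exists s, 0 < s < w /\ y = f s)) as [l [Hub Hleast]].
  - exists M; intros y [s [Hs ->]]; now apply HM.
  - exists (f (w / 2)), (w / 2); split; [lra | reflexivity].
  - exists l; split; [ | split].
    + apply Hleast; intros y [s [Hs ->]]; now apply HM.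
    + intros s Hs; apply Hub; now exists s.
    + apply filterlim_locally; intros eps; pose proof (cond_pos eps) as He.
      assert (Hs : exists s, 0 < s < w /\ l - eps < f s).
      { apply Classical_Prop.NNPP; intros Hn.
        assert (l <= l - eps); [ | lra].
        apply Hleast; intros y [s [Hs ->]].
        apply Rnot_lt_le; intros Hlt; apply Hn; now exists s. }
      destruct Hs as [s [Hs Hls]].
      exists (mkposreal (w - s) ltac:(lra)); intros y Hy Hyw.
      apply Rabs_lt_between' in Hy; simpl in Hy.
      pose proof (Hf s y ltac:(lra) ltac:(lra) Hyw).
      assert (f y <= l) by (apply Hub; exists y; split; [lra | reflexivity]).
      apply Rabs_lt_between'; lra.
Qed.

(** * Autonomous scalar equations with positive speed *)

Lemma primitive_through (f : R -> R) (alpha beta q0 v : R)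
    (Hq0 : alpha < q0 < beta)
    (Hc : forall q, alpha < q < beta -> continuous f q) :
  exists Phi : R -> R, Phi q0 = v /\
    forall q, alpha < q < beta -> is_derive Phi q (f q).
Proof.
  exists (fun q => v + RInt f q0 q); split.
  { rewrite RInt_point; apply Rplus_0_r. }
  intros q Hq.
  apply (is_derive_ext (fun t => plus v (RInt f q0 t))); [reflexivity | ].
  replace (f q) with (plus 0 (f q)) by apply Rplus_0_l.
  apply (is_derive_plus (fun _ => v) (RInt f q0)); [apply (is_derive_const v) | ].
  apply is_derive_RInt with q0; [ | now apply Hc].
  assert (Hr : 0 < Rmin (q - alpha) (beta - q)) by (apply Rmin_glb_lt; lra).
  exists (mkposreal _ Hr); intros y Hy; apply Rabs_lt_between' in Hy; simpl in Hy.
  pose proof (Rmin_l (q - alpha) (beta - q)).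
  pose proof (Rmin_r (q - alpha) (beta - q)).
  apply (RInt_correct (V := R_CompleteNormedModule)).
  apply (ex_RInt_continuous (V := R_CompleteNormedModule)).
  intros t [Ht1 Ht2]; apply Hc; split.
  - apply Rlt_le_trans with (Rmin q0 y); [apply Rmin_glb_lt; lra | exact Ht1].
  - apply Rle_lt_trans with (Rmax q0 y); [exact Ht2 | apply Rmax_lub_lt; lra].
Qed.

Lemma increasing_inverse (S S' : R -> R) (p q : R) (Hpq : p < q)
    (HS : forall y, p <= y <= q -> is_derive S y (S' y) /\ 0 < S' y) :
  exists T : R -> R, forall s, S p < s < S q ->
    p < T s < q /\ S (T s) = s /\ is_derive T s (/ S' (T s)).
Proof.
  assert (Hmono : forall y1 y2, p <= y1 -> y1 < y2 -> y2 <= q -> S y1 < S y2).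
  { intros y1 y2 H1 H12 H2.
    destruct (MVT_cor2 S S' y1 y2 H12) as [c [Hc Hcy]].
    - intros c Hc; apply is_derive_Reals, HS; lra.
    - assert (0 < S' c) by (apply HS; lra); nra. }
  assert (Hsol : forall s, {y | S p < s < S q -> p <= y <= q /\ S y = s}).
  { intros s.
    (* Outside the range of [S] the value is the default [0]. *)
    destruct (Rlt_dec (S p) s) as [H1 | H1]; [ | exists 0; intros; lra].
    destruct (Rlt_dec s (S q)) as [H2 | H2]; [ | exists 0; intros; lra].
    destruct (Ranalysis5.IVT_interv (fun y => S y - s) p q) as [y [Hy1 Hy2]]; try lra.
    - intros y Hy; apply continuity_pt_minus.
      + apply continuity_pt_filterlim.
        apply (ex_derive_continuous S); exists (S' y); now apply HS.
      + now apply continuity_pt_const.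
    - exists y; intros _; split; [exact Hy1 | lra]. }
  exists (fun s => proj1_sig (Hsol s)).
  set (T := fun s => proj1_sig (Hsol s)).
  assert (HT : forall s, S p < s < S q -> p < T s < q /\ S (T s) = s).
  { intros s Hs; unfold T; destruct (Hsol s) as [y Hy]; simpl.
    destruct (Hy Hs) as [[[H1 | H1] [H2 | H2]] H3]; try subst y; lra. }
  assert (HTlt : forall s t, S p < s < S q -> p <= t <= q -> (T s < t <-> s < S t)).
  { intros s t Hs Ht; destruct (HT s Hs) as [H1 H2].
    destruct (Rtotal_order (T s) t) as [H | [H | H]].
    - pose proof (Hmono (T s) t); lra.
    - subst t; lra.
    - pose proof (Hmono t (T s)); lra. }
  assert (HTgt : forall s t, S p < s < S q -> p <= t <= q -> (t < T s <-> S t < s)).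
  { intros s t Hs Ht; destruct (HT s Hs) as [H1 H2].
    destruct (Rtotal_order (T s) t) as [H | [H | H]].
    - pose proof (Hmono (T s) t); lra.
    - subst t; lra.
    - pose proof (Hmono t (T s)); lra. }
  intros s Hs; fold (T s); destruct (HT s Hs) as [Hts HSts].
  split; [exact Hts | split; [exact HSts | ]].
  assert (Hcont : continuity_pt T s).
  { apply continuity_pt_filterlim, filterlim_locally; intros eps.
    set (y1 := Rmax p (T s - eps / 2)); set (y2 := Rmin q (T s + eps / 2)).
    pose proof (cond_pos eps) as He.
    assert (Hy1 : p <= y1 /\ T s - eps < y1 < T s).
    { unfold y1; repeat split; [apply Rmax_l | | apply Rmax_lub_lt; lra].
      pose proof (Rmax_r p (T s - eps / 2)); lra. }
    assert (Hy2 : y2 <= q /\ T s < y2 < T s + eps).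
    { unfold y2; repeat split; [apply Rmin_l | apply Rmin_glb_lt; lra | ].
      pose proof (Rmin_r q (T s + eps / 2)); lra. }
    assert (HS1 : S p <= S y1 < s).
    { split; [ | rewrite <- HSts; apply Hmono; lra].
      destruct (Req_dec p y1) as [<- | Hn]; [lra | apply Rlt_le, Hmono; lra]. }
    assert (HS2 : s < S y2 <= S q).
    { split; [rewrite <- HSts; apply Hmono; lra | ].
      destruct (Req_dec y2 q) as [-> | Hn]; [lra | apply Rlt_le, Hmono; lra]. }
    assert (Hr : 0 < Rmin (s - S y1) (S y2 - s)) by (apply Rmin_glb_lt; lra).
    exists (mkposreal _ Hr); intros t Ht; apply Rabs_lt_between' in Ht; simpl in Ht.
    pose proof (Rmin_l (s - S y1) (S y2 - s)); pose proof (Rmin_r (s - S y1) (S y2 - s)).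
    apply Rabs_lt_between'.
    assert (y1 < T t) by (apply HTgt; lra).
    assert (T t < y2) by (apply HTlt; lra).
    lra. }
  set (lb := (S p + s) / 2); set (ub := (s + S q) / 2).
  assert (Hlb : S p < lb < s) by (unfold lb; lra).
  assert (Hub : s < ub < S q) by (unfold ub; lra).
  destruct (HT lb) as [Htl HSl]; [lra | ]; destruct (HT ub) as [Htu HSu]; [lra | ].
  assert (Prf : forall y, T lb <= y <= T ub -> derivable_pt S y).
  { intros y Hy; exists (S' y); apply is_derive_Reals, HS; lra. }
  assert (Prg : T lb <= T s <= T ub).
  { split; apply Rlt_le.
    - apply HTgt; lra.
    - apply HTlt; lra. }
  assert (HD : derive_pt S (T s) (Prf (T s) Prg) = S' (T s)).
  { apply derive_pt_eq_0, is_derive_Reals, HS; lra. }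
  assert (HSpos : 0 < S' (T s)) by (apply HS; lra).
  apply is_derive_Reals.
  replace (/ S' (T s)) with (1 / derive_pt S (T s) (Prf (T s) Prg))
    by (rewrite HD; unfold Rdiv; apply Rmult_1_l).
  apply (Ranalysis5.derivable_pt_lim_recip_interv S T lb ub); trivial; try lra.
  intros t Ht; destruct (HT t) as [_ Hid]; [lra | exact Hid].
Qed.

(** Since [F > 0], time is a function of position: [Phi q = w + int_Theta^q 1 / F]
    increases, and solutions are exactly the curves with [Phi (theta s) = s].  Its
    inverse [T] is therefore a solution, defined on both sides of [w], and any solution
    on the left of [w] arriving at [Theta] satisfies [Phi (theta s) - s = 0] because this
    difference is constant with limit [0]. *)
Lemma autonomous_ode_through (F : R -> R) (alpha beta Theta w : R)
    (HTheta : alpha < Theta < beta)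
    (HF : forall q, alpha < q < beta -> continuous F q /\ 0 < F q) :
  exists (a b : R) (T : R -> R), a < w < b /\
    (forall s, a < s < b -> alpha < T s < beta /\ is_derive T s (F (T s))) /\
    (forall (theta : R -> R) (c : R), a <= c < w ->
       (forall s, c < s < w -> alpha < theta s < beta /\ is_derive theta s (F (theta s))) ->
       filterlim theta (at_left w) (locally Theta) ->
       forall s, c < s < w -> theta s = T s).
Proof.
  destruct (primitive_through (fun q => / F q) alpha beta Theta w HTheta)
    as [Phi [HPhi HdPhi]].
  { intros q Hq; destruct (HF q Hq) as [Hc Hp].
    apply (continuous_comp F Rinv); [exact Hc | ].
    apply (ex_derive_continuous Rinv); auto_derive; lra. }
  assert (Hmono : forall y1 y2, alpha < y1 -> y1 < y2 -> y2 < beta -> Phi y1 < Phi y2).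
  { intros y1 y2 H1 H12 H2.
    destruct (MVT_cor2 Phi (fun q => / F q) y1 y2 H12) as [c [Hc Hcy]].
    - intros c Hc; apply is_derive_Reals, HdPhi; lra.
    - assert (0 < / F c) by (apply Rinv_0_lt_compat, HF; lra); nra. }
  destruct (increasing_inverse Phi (fun q => / F q) ((alpha + Theta) / 2)
    ((Theta + beta) / 2)) as [T HT]; [lra | | ].
  { intros y Hy; split; [apply HdPhi; lra | apply Rinv_0_lt_compat, HF; lra]. }
  exists (Phi ((alpha + Theta) / 2)), (Phi ((Theta + beta) / 2)), T.
  split; [ | split].
  - rewrite <- HPhi; split; apply Hmono; lra.
  - intros s Hs; destruct (HT s Hs) as [H1 [H2 H3]]; split; [lra | ].
    now rewrite Rinv_inv in H3.
  - intros theta c Hc Hth Hlim.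
    assert (Hd : forall s, c < s < w -> is_derive (fun t => Phi (theta t) - t) s 0).
    { intros s Hs; destruct (Hth s Hs) as [Hin Hds].
      pose proof (HdPhi _ Hin) as HdP; destruct (HF _ Hin) as [_ HFp].
      apply is_derive_Reals.
      replace 0 with (/ F (theta s) * F (theta s) - 1) by (field; lra).
      apply (derivable_pt_lim_minus (fun t => Phi (theta t)) (fun t => t)).
      - apply (derivable_pt_lim_comp theta Phi); now apply is_derive_Reals.
      - apply derivable_pt_lim_id. }
    assert (Hconst : forall s t, c < s -> s <= t -> t < w ->
      Phi (theta s) - s = Phi (theta t) - t).
    { intros s t Hs [Hst | ->] Ht; [ | reflexivity].
      destruct (MVT_cor2 (fun t => Phi (theta t) - t) (fun _ => 0) s t Hst) as [e [He _]].
      - intros e He; apply is_derive_Reals, Hd; lra.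
      - lra. }
    assert (HPl : filterlim (fun t => Phi (theta t) - t) (at_left w) (locally 0)).
    { replace 0 with (Phi Theta - w) by lra.
      apply (filterlim_comp_2 (G := locally (Phi Theta)) (H := locally (- w))
               (fun t => Phi (theta t)) (fun t => - t) Rplus).
      - apply filterlim_comp with (1 := Hlim).
        apply (ex_derive_continuous Phi); exists (/ F Theta); now apply HdPhi.
      - eapply filterlim_filter_le_1; [apply filter_le_within | apply (filterlim_opp w)].
      - apply (filterlim_plus (Phi Theta) (- w)). }
    intros s Hs.
    assert (Hzero : Phi (theta s) = s).
    { enough (Phi (theta s) - s = 0) by lra.
      apply (filterlim_locally_unique (F := at_left w) (fun t => Phi (theta t) - t));
        [ | exact HPl].
      apply filterlim_ext_loc with (fun _ => Phi (theta s) - s); [ | apply filterlim_const].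
      assert (Hr : 0 < w - s) by lra.
      exists (mkposreal _ Hr); intros y Hy Hyw; apply Rabs_lt_between' in Hy; simpl in Hy.
      apply Hconst; lra. }
    destruct (Hth s Hs) as [Hin _].
    assert (Hab : w < Phi ((Theta + beta) / 2)) by (rewrite <- HPhi; apply Hmono; lra).
    destruct (HT s) as [HTin [HTs _]]; [lra | ].
    destruct (Rtotal_order (theta s) (T s)) as [H | [H | H]]; [ | exact H | ].
    + pose proof (Hmono (theta s) (T s)); lra.
    + pose proof (Hmono (T s) (theta s)); lra.
Qed.

(** * One-sided differentiability and gluing of solutions *)

Lemma limit1_in_local (f g : R -> R) (D D' : R -> Prop) (l x0 r : R) (Hr : 0 < r)
    (Hfg : forall y, Rabs (y - x0) < r -> D' y -> D y /\ f y = g y) :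
  limit1_in f D l x0 -> limit1_in g D' l x0.
Proof.
  intros Hlim eps Heps; destruct (Hlim eps Heps) as [alp [Halp Hf]].
  exists (Rmin alp r); split; [now apply Rmin_glb_lt | ].
  intros y [HDy Hy]; simpl in *; unfold Rdist in *.
  destruct (Hfg y) as [HD <-]; [ | exact HDy | ].
  - apply Rlt_le_trans with (1 := Hy), Rmin_r.
  - apply Hf; split; [exact HD | ].
    apply Rlt_le_trans with (1 := Hy), Rmin_l.
Qed.

Lemma Rbar_lt_dense (s : R) (omega : Rbar) :
  Rbar_lt s omega -> exists t : R, s < t /\ Rbar_lt t omega.
Proof.
  destruct omega as [w | | ]; simpl; intros H; [ | | easy].
  - exists ((s + w) / 2); lra.
  - exists (s + 1); split; [lra | exact I].
Qed.

Lemma Rbar_lt_below (s t : R) (omega : Rbar) : s <= t -> Rbar_lt t omega -> Rbar_lt s omega.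
Proof. intros Hst Ht; now apply (Rbar_le_lt_trans _ t). Qed.

Lemma D_in_interior (f d : R -> R) (omega : Rbar) (s : R) :
  0 < s -> Rbar_lt s omega -> D_in f d (dom omega) s -> is_derive f s (d s).
Proof.
  intros Hs Hso Hd; apply is_derive_Reals, derivable_pt_lim_D_in.
  destruct (Rbar_lt_dense s omega Hso) as [t [Hst Hto]].
  assert (Hr : 0 < Rmin s (t - s)) by (apply Rmin_glb_lt; lra).
  apply limit1_in_local with (3 := Hd) (1 := Hr).
  intros y Hy [_ Hne]; apply Rabs_lt_between' in Hy.
  pose proof (Rmin_l s (t - s)); pose proof (Rmin_r s (t - s)).
  repeat split; [lra | | exact Hne].
  apply (Rbar_le_lt_trans _ t); [simpl; lra | exact Hto].
Qed.

Lemma limit1_in_at_right (f : R -> R) (omega : Rbar) (l : R) :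
  Rbar_lt 0 omega -> limit1_in f (D_x (dom omega) 0) l 0 ->
  filterlim f (at_right 0) (locally l).
Proof.
  intros Ho Hf; apply filterlim_locally; intros eps.
  destruct (Hf eps (cond_pos eps)) as [alp [Halp Hlim]].
  destruct (Rbar_lt_dense 0 omega Ho) as [t [Ht Hto]].
  exists (mkposreal _ (Rmin_glb_lt _ _ _ Halp Ht)); intros y Hy Hy0.
  apply Rabs_lt_between' in Hy; simpl in Hy.
  pose proof (Rmin_l alp t); pose proof (Rmin_r alp t).
  apply Hlim; repeat split.
  - lra.
  - apply (Rbar_le_lt_trans _ t); [simpl; lra | exact Hto].
  - lra.
  - apply Rabs_lt_between'; lra.
Qed.

Lemma C1_on_right_continuous (f : R -> R) (omega : Rbar) :
  Rbar_lt 0 omega -> C1_on (dom omega) f -> filterlim f (at_right 0) (locally (f 0)).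
Proof.
  intros Ho [d Hd]; apply limit1_in_at_right with (1 := Ho).
  apply (cont_deriv f d); apply Hd; split; [lra | exact Ho].
Qed.

(** At [0] the one-sided derivative of [f] is kept; at positive points the derivative is
    the explicit [e], which agrees with that of [f] before [w] by uniqueness. *)
Lemma C1_on_extend (f g e : R -> R) (w b : R) (Hw : 0 < w)
    (Hf : C1_on (dom w) f)
    (Hfg : forall s, 0 <= s < w -> g s = f s)
    (Hd : forall s, 0 < s < b -> is_derive g s (e s))
    (Hc : forall s, 0 < s < b -> continuous e s) (Hwb : w < b) :
  C1_on (dom b) g.
Proof.
  destruct Hf as [d Hfd].
  assert (Hde : forall s, 0 < s < w -> d s = e s).
  { intros s Hs; destruct (Hfd s) as [H1 _]; [split; simpl; lra | ].
    apply D_in_interior in H1; simpl; try lra.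
    rewrite <- (is_derive_unique _ _ _ H1); apply is_derive_unique.
    apply is_derive_ext_loc with (2 := Hd s ltac:(lra)).
    assert (Hr : 0 < Rmin s (w - s)) by (apply Rmin_glb_lt; lra).
    exists (mkposreal _ Hr); intros y Hy; apply Rabs_lt_between' in Hy; simpl in Hy.
    pose proof (Rmin_l s (w - s)); pose proof (Rmin_r s (w - s)).
    apply Hfg; lra. }
  exists (fun s => if Rle_dec s 0 then d 0 else e s).
  intros s [[Hs | <-] Hsb]; simpl in Hsb.
  - assert (He : (if Rle_dec s 0 then d 0 else e s) = e s) by (destruct (Rle_dec s 0); lra).
    split.
    + unfold D_in; rewrite He.
      assert (H1 : D_in g (fun _ => e s) no_cond s).
      { apply derivable_pt_lim_D_in, is_derive_Reals, Hd; lra. }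
      apply limit1_in_local with (3 := H1) (r := 1); [lra | ].
      intros y _ [_ Hne]; repeat split; exact Hne.
    + unfold continue_in; rewrite He.
      assert (H1 : continuity_pt e s) by (apply continuity_pt_filterlim, Hc; lra).
      apply limit1_in_local with (3 := H1) (1 := Hs).
      intros y Hy [_ Hne]; apply Rabs_lt_between' in Hy.
      repeat split; [exact Hne | destruct (Rle_dec y 0); lra].
  - destruct (Hfd 0) as [H1 H2]; [split; simpl; lra | ].
    assert (He : (if Rle_dec 0 0 then d 0 else e 0) = d 0) by (destruct (Rle_dec 0 0); lra).
    split.
    + unfold D_in; rewrite He.
      apply limit1_in_local with (3 := H1) (1 := Hw).
      intros y Hy [[Hy0 _] Hne]; apply Rabs_lt_between' in Hy.
      repeat split; simpl; try lra.
      now rewrite !Hfg by lra.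
    + unfold continue_in; rewrite He.
      apply limit1_in_local with (3 := H2) (1 := Hw).
      intros y Hy [[Hy0 _] Hne]; apply Rabs_lt_between' in Hy.
      repeat split; simpl; try lra.
      destruct (Rle_dec y 0); [lra | apply Hde; lra].
Qed.

Definition glue (w : R) (f g : R -> R) (s : R) : R :=
  if Rlt_dec s w then f s else g s.

Lemma glue_left (w : R) (f g : R -> R) (s : R) : s < w -> glue w f g s = f s.
Proof. unfold glue; destruct (Rlt_dec s w); lra. Qed.

Lemma glue_right (w : R) (f g : R -> R) (s : R) : w <= s -> glue w f g s = g s.
Proof. unfold glue; destruct (Rlt_dec s w); lra. Qed.

Lemma is_derive_glue (f g f' g' : R -> R) (a w b : R) (Ha : 0 <= a < w) (Hwb : w < b)
    (Hf : forall s, 0 < s < w -> is_derive f s (f' s))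
    (Hg : forall s, a < s < b -> is_derive g s (g' s))
    (Hfg : forall s, a < s < w -> g s = f s) (s : R) :
  0 < s < b -> is_derive (glue w f g) s (glue w f' g' s).
Proof.
  intros Hs; destruct (Rlt_le_dec s w) as [Hsw | Hsw].
  - rewrite glue_left by exact Hsw.
    apply is_derive_ext_loc with f; [ | apply Hf; lra].
    exists (mkposreal (w - s) ltac:(lra)); intros y Hy.
    apply Rabs_lt_between' in Hy; simpl in Hy; rewrite glue_left; lra.
  - rewrite glue_right by exact Hsw.
    apply is_derive_ext_loc with g; [ | apply Hg; lra].
    exists (mkposreal (s - a) ltac:(lra)); intros y Hy.
    apply Rabs_lt_between' in Hy; simpl in Hy.
    unfold glue; destruct (Rlt_dec y w); [apply Hfg; lra | reflexivity].
Qed.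

(** The second solution overlaps the first on [(a, w)], so near every point the glued
    triple coincides with one of the two, and every clause is local. *)
Lemma solution_glue (lambda a w b : R) (x z theta X Z T : R -> R)
    (Hsol : is_solution lambda w x z theta) (Ha : 0 <= a < w) (Hwb : w < b)
    (HX : forall s, a < s < b -> 0 < X s)
    (HT : forall s, a < s < b -> sin (T s) <> 0)
    (HdX : forall s, a < s < b -> is_derive X s (cos (T s)))
    (HdZ : forall s, a < s < b -> is_derive Z s (sin (T s)))
    (HdT : forall s, a < s < b ->
       is_derive T s (X s * (cos (T s) / sin (T s)) + lambda * (X s / sin (T s))))
    (Hagree : forall s, a < s < w -> X s = x s /\ Z s = z s /\ T s = theta s) :
  exists x' z' theta' : R -> R,
    is_solution lambda b x' z' theta' /\
    forall s, dom w s -> x' s = x s /\ z' s = z s /\ theta' s = theta s.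
Proof.
  destruct Hsol as [C1 C2 C3 I1 I2 I3 Px Ps D1 D2 D3].
  exists (glue w x X), (glue w z Z), (glue w theta T).
  set (x' := glue w x X); set (z' := glue w z Z); set (t' := glue w theta T).
  assert (Hcase : forall s, 0 < s < b ->
    (s < w /\ x' s = x s /\ z' s = z s /\ t' s = theta s) \/
    (a < s < b /\ w <= s /\ x' s = X s /\ z' s = Z s /\ t' s = T s)).
  { intros s Hs; unfold x', z', t'; destruct (Rlt_le_dec s w) as [H | H].
    - left; rewrite !glue_left; auto.
    - right; rewrite !glue_right; repeat split; auto; lra. }
  assert (Hx : forall s, 0 < s < b -> is_derive x' s (cos (t' s))).
  { intros s Hs.
    replace (cos (t' s)) with (glue w (fun s => cos (theta s)) (fun s => cos (T s)) s).
    - apply is_derive_glue with a b; trivial.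
      + intros r Hr; apply D1; simpl; lra.
      + intros r Hr; now apply Hagree.
    - unfold t', glue; destruct (Rlt_dec s w); reflexivity. }
  assert (Hz : forall s, 0 < s < b -> is_derive z' s (sin (t' s))).
  { intros s Hs.
    replace (sin (t' s)) with (glue w (fun s => sin (theta s)) (fun s => sin (T s)) s).
    - apply is_derive_glue with a b; trivial.
      + intros r Hr; apply D2; simpl; lra.
      + intros r Hr; now apply Hagree.
    - unfold t', glue; destruct (Rlt_dec s w); reflexivity. }
  assert (Ht : forall s, 0 < s < b -> is_derive t' s
    (x' s * (cos (t' s) / sin (t' s)) + lambda * (x' s / sin (t' s)))).
  { intros s Hs.
    replace (x' s * (cos (t' s) / sin (t' s)) + lambda * (x' s / sin (t' s))) with
      (glue w (fun s => x s * (cos (theta s) / sin (theta s)) + lambda * (x s / sin (theta s)))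
        (fun s => X s * (cos (T s) / sin (T s)) + lambda * (X s / sin (T s))) s).
    - apply is_derive_glue with a b; trivial.
      + intros r Hr; apply D3; simpl; lra.
      + intros r Hr; now apply Hagree.
    - unfold x', t', glue; destruct (Rlt_dec s w); reflexivity. }
  assert (Hsin : forall s, 0 < s < b -> sin (t' s) <> 0).
  { intros s Hs; destruct (Hcase s Hs) as [[H1 [_ [_ ->]]] | [H1 [_ [_ [_ ->]]]]]; auto.
    apply Ps; simpl; lra. }
  assert (Hct : forall s, 0 < s < b -> continuous t' s).
  { intros s Hs; apply (ex_derive_continuous t'); eexists; now apply Ht. }
  split.
  - split.
    + apply (C1_on_extend x x' (fun s => cos (t' s)) w b); trivial; try lra.
      * intros s Hs; unfold x'; now rewrite glue_left.
      * intros s Hs; apply (continuous_comp t' cos); [now apply Hct | ].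
        apply (ex_derive_continuous cos); auto_derive; exact I.
    + apply (C1_on_extend z z' (fun s => sin (t' s)) w b); trivial; try lra.
      * intros s Hs; unfold z'; now rewrite glue_left.
      * intros s Hs; apply (continuous_comp t' sin); [now apply Hct | ].
        apply (ex_derive_continuous sin); auto_derive; exact I.
    + apply (C1_on_extend theta t' (fun s => x' s * (cos (t' s) / sin (t' s))
        + lambda * (x' s / sin (t' s))) w b); trivial; try lra.
      * intros s Hs; unfold t'; now rewrite glue_left.
      * intros s Hs; apply (ex_derive_continuous (fun s => x' s * (cos (t' s) / sin (t' s))
          + lambda * (x' s / sin (t' s)))).
        assert (ex_derive x' s) by (eexists; now apply Hx).
        assert (ex_derive t' s) by (eexists; now apply Ht).
        auto_derive; repeat split; trivial; now apply Hsin.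
    + unfold x'; rewrite glue_left; trivial; lra.
    + unfold z'; rewrite glue_left; trivial; lra.
    + unfold t'; rewrite glue_left; trivial; lra.
    + intros s Hs Hsb; simpl in Hsb.
      destruct (Hcase s (conj Hs Hsb)) as [[H1 [-> _]] | [H1 [_ [-> _]]]]; auto.
    + intros s Hs Hsb; now apply Hsin.
    + intros s Hs Hsb; now apply Hx.
    + intros s Hs Hsb; now apply Hz.
    + intros s Hs Hsb; now apply Ht.
  - intros s [Hs Hsw]; unfold x', z', t'; rewrite !glue_left; auto.
Qed.

(** * Limits along filters *)

Lemma filterlim_Rplus (F : (R -> Prop) -> Prop) {FF : Filter F} (f g : R -> R) (a b : R) :
  filterlim f F (locally a) -> filterlim g F (locally b) ->
  filterlim (fun t => f t + g t) F (locally (a + b)).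
Proof.
  intros Hf Hg; apply (filterlim_comp_2 f g Rplus Hf Hg), (filterlim_plus a b).
Qed.

Lemma filterlim_Rmult (F : (R -> Prop) -> Prop) {FF : Filter F} (f g : R -> R) (a b : R) :
  filterlim f F (locally a) -> filterlim g F (locally b) ->
  filterlim (fun t => f t * g t) F (locally (a * b)).
Proof.
  intros Hf Hg; apply (filterlim_comp_2 f g Rmult Hf Hg), (filterlim_mult a b).
Qed.

Lemma filterlim_continuous (F : (R -> Prop) -> Prop) {FF : Filter F} (f h : R -> R) (a : R) :
  filterlim f F (locally a) -> continuous h a ->
  filterlim (fun t => h (f t)) F (locally (h a)).
Proof. intros Hf Hh; exact (filterlim_comp _ _ _ f h _ _ _ Hf Hh). Qed.

Lemma at_right_id (a : R) : filterlim (fun t : R => t) (at_right a) (locally a).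
Proof. apply filter_le_within. Qed.

Lemma continuous_cos (a : R) : continuous cos a.
Proof. apply (ex_derive_continuous cos); auto_derive; exact I. Qed.

Lemma continuous_sin (a : R) : continuous sin a.
Proof. apply (ex_derive_continuous sin); auto_derive; exact I. Qed.

Lemma locally_positive (f : R -> R) (a : R) :
  continuous f a -> 0 < f a -> locally a (fun q => 0 < f q).
Proof.
  intros Hf Ha; apply (Hf (fun y => 0 < y)).
  now apply (open_gt 0).
Qed.

Lemma at_right_positive (f : R -> R) (l : R) :
  filterlim f (at_right 0) (locally l) -> 0 < l ->
  exists r, 0 < r /\ forall s, 0 < s < r -> 0 < f s.
Proof.
  intros Hf Hl; destruct (proj1 (filterlim_locally f l) Hf (mkposreal l Hl)) as [r Hr].
  exists r; split; [apply cond_pos | ]; intros s Hs.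
  assert (Hb : ball l l (f s)).
  { apply Hr; [ | lra]. apply Rabs_lt_between'; simpl; lra. }
  apply Rabs_lt_between' in Hb; lra.
Qed.

(** * Solutions with positive sine: phase, energy and monotonicity *)

(** The normalization reached by the reflection [(x, z, theta) -> (x, - z, - theta)]. *)
Record upward_solution (lambda : R) (omega : Rbar) (x z theta : R -> R) : Prop := {
  up_lambda : -1 < lambda;
  up_omega : Rbar_lt 0 omega;
  up_solution : is_solution lambda omega x z theta;
  up_sin : forall s : R, 0 < s -> Rbar_lt s omega -> 0 < sin (theta s)
}.

Lemma x_right_continuous lambda omega x z theta
    (H : upward_solution lambda omega x z theta) :
  filterlim x (at_right 0) (locally (x 0)).
Proof.
  apply C1_on_right_continuous with omega; [apply H | ].
  apply (sol_C1_x _ _ _ _ _ (up_solution _ _ _ _ _ H)).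
Qed.

Lemma z_right_continuous lambda omega x z theta
    (H : upward_solution lambda omega x z theta) :
  filterlim z (at_right 0) (locally (z 0)).
Proof.
  apply C1_on_right_continuous with omega; [apply H | ].
  apply (sol_C1_z _ _ _ _ _ (up_solution _ _ _ _ _ H)).
Qed.

Lemma theta_right_continuous lambda omega x z theta
    (H : upward_solution lambda omega x z theta) :
  filterlim theta (at_right 0) (locally (theta 0)).
Proof.
  apply C1_on_right_continuous with omega; [apply H | ].
  apply (sol_C1_theta _ _ _ _ _ (up_solution _ _ _ _ _ H)).
Qed.

Lemma cos_right_continuous lambda omega x z theta
    (H : upward_solution lambda omega x z theta) :
  filterlim (fun t => cos (theta t)) (at_right 0) (locally (cos (theta 0))).
Proof.
  apply filterlim_continuous; [apply at_right_proper_filter | | apply continuous_cos].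
  now apply theta_right_continuous with lambda omega x z.
Qed.

Lemma x_derive lambda omega x z theta (H : upward_solution lambda omega x z theta) (s : R) :
  0 < s -> Rbar_lt s omega -> is_derive x s (cos (theta s)).
Proof. apply (sol_x _ _ _ _ _ (up_solution _ _ _ _ _ H)). Qed.

Lemma z_derive lambda omega x z theta (H : upward_solution lambda omega x z theta) (s : R) :
  0 < s -> Rbar_lt s omega -> is_derive z s (sin (theta s)).
Proof. apply (sol_z _ _ _ _ _ (up_solution _ _ _ _ _ H)). Qed.

Lemma x_pos lambda omega x z theta (H : upward_solution lambda omega x z theta) (s : R) :
  0 < s -> Rbar_lt s omega -> 0 < x s.
Proof. apply (sol_x_pos _ _ _ _ _ (up_solution _ _ _ _ _ H)). Qed.

Lemma theta_derive lambda omega x z theta (H : upward_solution lambda omega x z theta) (s : R) :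
  0 < s -> Rbar_lt s omega ->
  is_derive theta s (x s * (cos (theta s) + lambda) / sin (theta s)).
Proof.
  intros Hs Hso; pose proof (up_sin _ _ _ _ _ H s Hs Hso).
  replace (x s * (cos (theta s) + lambda) / sin (theta s)) with
    (x s * (cos (theta s) / sin (theta s)) + lambda * (x s / sin (theta s))) by (field; lra).
  now apply (sol_theta _ _ _ _ _ (up_solution _ _ _ _ _ H)).
Qed.

Lemma initial_values lambda omega x z theta (H : upward_solution lambda omega x z theta) :
  x 0 = 0 /\ z 0 = 0 /\ theta 0 = 0.
Proof. destruct (up_solution _ _ _ _ _ H); auto. Qed.

Lemma cos_theta_derive lambda omega x z theta
    (H : upward_solution lambda omega x z theta) (s : R) :
  0 < s -> Rbar_lt s omega ->
  is_derive (fun t => cos (theta t)) s (- (x s * (cos (theta s) + lambda))).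
Proof.
  intros Hs Hso; pose proof (up_sin _ _ _ _ _ H s Hs Hso).
  pose proof (theta_derive _ _ _ _ _ H s Hs Hso) as Hd.
  apply is_derive_Reals.
  replace (- (x s * (cos (theta s) + lambda))) with
    (- sin (theta s) * (x s * (cos (theta s) + lambda) / sin (theta s))) by (field; lra).
  apply (derivable_pt_lim_comp theta cos); [now apply is_derive_Reals | ].
  apply derivable_pt_lim_cos.
Qed.

Lemma x_le_arclength lambda omega x z theta
    (H : upward_solution lambda omega x z theta) (s : R) :
  0 <= s -> Rbar_lt s omega -> x s <= s.
Proof.
  intros Hs Hso.
  enough (0 - x 0 <= s - x s) by (destruct (initial_values _ _ _ _ _ H); lra).
  apply (nondecreasing_from_start (fun t => t - x t) (fun t => 1 - cos (theta t)) omega);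
    trivial; try lra.
  - apply (filterlim_Rplus (at_right 0) (fun t => t) (fun t => - x t)).
    + apply at_right_id.
    + apply (filterlim_comp _ _ _ x Ropp _ _ _ (x_right_continuous _ _ _ _ _ H)).
      apply (filterlim_opp (x 0)).
  - intros t Ht Hto; apply is_derive_Reals.
    apply (derivable_pt_lim_minus (fun t => t) x); [apply derivable_pt_lim_id | ].
    now apply is_derive_Reals, (x_derive _ _ _ _ _ H).
  - intros t _ _; pose proof (COS_bound (theta t)); lra.
Qed.

(** With [u = cos theta + lambda], the equation [u' = - x u] and [x s <= s] make
    [u^2 exp (s^2)] nondecreasing.  Squaring is what avoids assuming the sign of [u]:
    the bound on [u^2] shows that [u] never vanishes, and then its sign is that of
    [u 0 = 1 + lambda]. *)
Lemma cos_plus_lambda_bound lambda omega x z theta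
    (H : upward_solution lambda omega x z theta) (s : R) :
  0 <= s -> Rbar_lt s omega ->
  (1 + lambda) * exp (- s ^ 2 / 2) <= cos (theta s) + lambda.
Proof.
  pose proof (up_lambda _ _ _ _ _ H) as Hl.
  destruct (initial_values _ _ _ _ _ H) as [Hx0 [_ Ht0]].
  assert (Hsq : forall t, 0 <= t -> Rbar_lt t omega ->
    ((1 + lambda) * exp (- t ^ 2 / 2)) ^ 2 <= (cos (theta t) + lambda) ^ 2).
  { intros t Ht Hto.
    assert (Hm : (1 + lambda) ^ 2 <= (cos (theta t) + lambda) ^ 2 * exp (t ^ 2)).
    { replace ((1 + lambda) ^ 2) with ((cos (theta 0) + lambda) ^ 2 * exp (0 ^ 2)).
      2:{ rewrite Ht0, cos_0; replace (0 ^ 2) with 0 by ring; rewrite exp_0; ring. }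
      apply (nondecreasing_from_start (fun t => (cos (theta t) + lambda) ^ 2 * exp (t ^ 2))
        (fun t => 2 * (cos (theta t) + lambda) ^ 2 * exp (t ^ 2) * (t - x t)) omega);
        trivial; try lra.
      - apply filterlim_Rmult; [apply at_right_proper_filter | | ].
        + apply (filterlim_continuous (at_right 0) _ (fun y => (y + lambda) ^ 2)).
          * now apply (cos_right_continuous _ _ _ _ _ H).
          * apply (ex_derive_continuous (fun y => (y + lambda) ^ 2)); auto_derive; exact I.
        + apply (filterlim_continuous (at_right 0) (fun t => t) (fun y => exp (y ^ 2))).
          * apply at_right_id.
          * apply (ex_derive_continuous (fun y => exp (y ^ 2))); auto_derive; exact I.
      - intros r Hr Hro; pose proof (cos_theta_derive _ _ _ _ _ H r Hr Hro) as Hd.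
        set (c := fun t => cos (theta t)) in *.
        apply (is_derive_ext (fun t => (c t + lambda) ^ 2 * exp (t ^ 2))); [reflexivity | ].
        fold (c r) in *; auto_derive; [now exists (- (x r * (c r + lambda))) | ].
        replace (Derive (fun x => c x) r) with (- (x r * (c r + lambda)))
          by (symmetry; now apply is_derive_unique).
        change (exp (r * (r * 1))) with (exp (r ^ 2)); ring.
      - intros r Hr Hro.
        pose proof (x_le_arclength _ _ _ _ _ H r ltac:(lra) Hro).
        pose proof (pow2_ge_0 (cos (theta r) + lambda)); pose proof (exp_pos (r ^ 2)).
        apply Rmult_le_pos; [apply Rmult_le_pos; [lra | now apply Rlt_le] | lra]. }
    assert (He : exp (t ^ 2) * exp (- t ^ 2) = 1) by (rewrite exp_Ropp; field; apply exp_neq_0).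
    replace ((cos (theta t) + lambda) ^ 2)
      with ((cos (theta t) + lambda) ^ 2 * exp (t ^ 2) * exp (- t ^ 2))
      by (rewrite Rmult_assoc, He; ring).
    replace (((1 + lambda) * exp (- t ^ 2 / 2)) ^ 2)
      with ((1 + lambda) ^ 2 * (exp (- t ^ 2 / 2) * exp (- t ^ 2 / 2))) by ring.
    rewrite <- exp_plus; replace (- t ^ 2 / 2 + - t ^ 2 / 2) with (- t ^ 2) by field.
    apply Rmult_le_compat_r; [left; apply exp_pos | exact Hm]. }
  assert (Hpos : forall t, 0 < (1 + lambda) * exp (- t ^ 2 / 2))
    by (intros t; apply Rmult_lt_0_compat; [lra | apply exp_pos]).
  assert (Hu : forall t, 0 < t -> Rbar_lt t omega -> 0 < cos (theta t) + lambda).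
  { destruct (at_right_positive (fun t => cos (theta t) + lambda) (1 + lambda))
      as [r [Hr Hrp]]; [ | lra | ].
    - apply filterlim_Rplus; [apply at_right_proper_filter | | apply filterlim_const].
      replace 1 with (cos (theta 0)) by (rewrite Ht0; apply cos_0).
      now apply (cos_right_continuous _ _ _ _ _ H).
    - destruct (Rbar_lt_dense 0 omega (up_omega _ _ _ _ _ H)) as [t0 [Ht00 Ht0o]].
      pose proof (Rmin_l r t0); pose proof (Rmin_r r t0).
      assert (0 < Rmin r t0) by now apply Rmin_glb_lt.
      apply (nonvanishing_constant_sign (fun t => cos (theta t) + lambda) omega)
        with (a := Rmin r t0 / 2); try lra.
      + intros t Ht Hto; apply (ex_derive_continuous (fun t => cos (theta t) + lambda)).
        apply (ex_derive_plus (fun t => cos (theta t)) (fun _ => lambda)).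
        * eexists; now apply (cos_theta_derive _ _ _ _ _ H).
        * apply ex_derive_const.
      + intros t Ht Hto He; pose proof (Hsq t ltac:(lra) Hto) as Hs.
        rewrite He in Hs; pose proof (Hpos t); nra.
      + apply Rbar_lt_below with (2 := Ht0o); lra.
      + apply Hrp; lra. }
  intros [Hs | <-] Hso.
  - pose proof (Hsq s ltac:(lra) Hso); pose proof (Hpos s); pose proof (Hu s Hs Hso).
    apply Rsqr_incr_0; [rewrite !Rsqr_pow2 | | ]; lra.
  - rewrite Ht0, cos_0; replace (- 0 ^ 2 / 2) with 0 by field; rewrite exp_0; lra.
Qed.

Lemma cos_plus_lambda_pos lambda omega x z theta
    (H : upward_solution lambda omega x z theta) (s : R) :
  0 <= s -> Rbar_lt s omega -> 0 < cos (theta s) + lambda.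
Proof.
  intros Hs Hso; apply Rlt_le_trans with (2 := cos_plus_lambda_bound _ _ _ _ _ H s Hs Hso).
  apply Rmult_lt_0_compat; [pose proof (up_lambda _ _ _ _ _ H); lra | apply exp_pos].
Qed.

(** A primitive of [p / (p + lambda)]: along a solution
    [x x' = - x' x'' / (x' + lambda)], so [potential lambda x' + x^2 / 2] is conserved. *)
Definition potential (lambda p : R) : R := p - lambda * ln (p + lambda).

Lemma potential_derive (lambda p : R) :
  0 < p + lambda -> is_derive (potential lambda) p (p / (p + lambda)).
Proof. intros Hp; unfold potential; auto_derive; [lra | field; lra]. Qed.

Lemma energy lambda omega x z theta (H : upward_solution lambda omega x z theta) (s : R) :
  0 <= s -> Rbar_lt s omega ->
  potential lambda (cos (theta s)) + (x s) ^ 2 / 2 = potential lambda 1.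
Proof.
  intros Hs Hso; destruct (initial_values _ _ _ _ _ H) as [Hx0 [_ Ht0]].
  rewrite (constant_from_start (fun t => potential lambda (cos (theta t)) + (x t) ^ 2 / 2)
    omega) with (s := s); trivial.
  - rewrite Hx0, Ht0, cos_0; field.
  - apply filterlim_Rplus; [apply at_right_proper_filter | | ].
    + apply (filterlim_continuous (at_right 0) _ (potential lambda)).
      * now apply (cos_right_continuous _ _ _ _ _ H).
      * apply (ex_derive_continuous (potential lambda)); eexists; apply potential_derive.
        apply (cos_plus_lambda_pos _ _ _ _ _ H); [lra | apply (up_omega _ _ _ _ _ H)].
    + apply (filterlim_continuous (at_right 0) x (fun y => y ^ 2 / 2)).
      * now apply (x_right_continuous _ _ _ _ _ H).
      * apply (ex_derive_continuous (fun y => y ^ 2 / 2)); auto_derive; exact I.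
  - intros t Ht Hto.
    pose proof (cos_plus_lambda_pos _ _ _ _ _ H t ltac:(lra) Hto) as Hu.
    apply is_derive_Reals.
    replace 0 with (cos (theta t) / (cos (theta t) + lambda)
      * (- (x t * (cos (theta t) + lambda))) + x t * cos (theta t)) by (field; lra).
    apply (derivable_pt_lim_plus (fun t => potential lambda (cos (theta t)))
      (fun t => x t ^ 2 / 2)).
    + apply (derivable_pt_lim_comp (fun t => cos (theta t)) (potential lambda)).
      * now apply is_derive_Reals, (cos_theta_derive _ _ _ _ _ H).
      * now apply is_derive_Reals, potential_derive.
    + apply (derivable_pt_lim_comp x (fun y => y ^ 2 / 2)).
      * now apply is_derive_Reals, (x_derive _ _ _ _ _ H).
      * apply is_derive_Reals; auto_derive; [exact I | field].
Qed.

(** Near [0] the angle is small and has a positive sine, so it is positive; afterwards it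
    cannot cross [0] or [PI], where the sine vanishes. *)
Lemma theta_range lambda omega x z theta
    (H : upward_solution lambda omega x z theta) (s : R) :
  0 < s -> Rbar_lt s omega -> 0 < theta s < PI.
Proof.
  destruct (initial_values _ _ _ _ _ H) as [_ [_ Ht0]].
  pose proof PI_RGT_0 as HPI.
  assert (Hc : forall t, 0 < t -> Rbar_lt t omega -> continuous theta t).
  { intros t Ht Hto; apply (ex_derive_continuous theta); eexists.
    now apply (theta_derive _ _ _ _ _ H). }
  pose proof (theta_right_continuous _ _ _ _ _ H) as Hr; rewrite Ht0 in Hr.
  destruct (proj1 (filterlim_locally theta 0) Hr (mkposreal PI HPI)) as [r Hrb].
  destruct (Rbar_lt_dense 0 omega (up_omega _ _ _ _ _ H)) as [t0 [Ht00 Ht0o]].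
  pose proof (Rmin_l r t0); pose proof (Rmin_r r t0).
  assert (0 < Rmin r t0) by (apply Rmin_glb_lt; [apply cond_pos | lra]).
  set (a := Rmin r t0 / 2).
  assert (Ha : 0 < a) by (unfold a; lra).
  assert (Hao : Rbar_lt a omega) by (apply Rbar_lt_below with (2 := Ht0o); unfold a; lra).
  assert (Hth : - PI < theta a < PI).
  { assert (Hb : ball 0 PI (theta a)).
    { apply Hrb; [ | exact Ha]. apply Rabs_lt_between'; simpl; unfold a; lra. }
    apply Rabs_lt_between' in Hb; lra. }
  pose proof (up_sin _ _ _ _ _ H) as Hsin.
  assert (Hth0 : 0 < theta a).
  { destruct (Rlt_le_dec 0 (theta a)) as [Hp | [Hn | He]]; [exact Hp | | ]; exfalso.
    - pose proof (sin_gt_0 (- theta a) ltac:(lra) ltac:(lra)) as Hs.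
      rewrite sin_neg in Hs; pose proof (Hsin a Ha Hao); lra.
    - pose proof (Hsin a Ha Hao) as Hs; rewrite He, sin_0 in Hs; lra. }
  intros Hs Hso; split.
  - apply (nonvanishing_constant_sign theta omega) with (a := a); trivial.
    intros t Ht Hto He; pose proof (Hsin t Ht Hto) as Hst; rewrite He, sin_0 in Hst; lra.
  - enough (0 < PI - theta s) by lra.
    apply (nonvanishing_constant_sign (fun t => PI - theta t) omega) with (a := a);
      trivial; try lra.
    + intros t Ht Hto; apply (continuous_minus (fun _ => PI) theta);
        [apply continuous_const | now apply Hc].
    + intros t Ht Hto He; pose proof (Hsin t Ht Hto) as Hst.
      replace (theta t) with PI in Hst by lra; rewrite sin_PI in Hst; lra.
Qed.

Lemma theta_derivative_pos lambda omega x z theta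
    (H : upward_solution lambda omega x z theta) (s : R) :
  0 < s -> Rbar_lt s omega -> 0 < x s * (cos (theta s) + lambda) / sin (theta s).
Proof.
  intros Hs Hso; apply Rdiv_lt_0_compat; [apply Rmult_lt_0_compat | ].
  - now apply (x_pos _ _ _ _ _ H).
  - apply (cos_plus_lambda_pos _ _ _ _ _ H); [lra | exact Hso].
  - now apply (up_sin _ _ _ _ _ H).
Qed.

Lemma theta_increasing lambda omega x z theta
    (H : upward_solution lambda omega x z theta) (a b : R) :
  0 <= a -> a < b -> Rbar_lt b omega -> theta a < theta b.
Proof.
  apply (increasing_from_start theta _ omega (theta_right_continuous _ _ _ _ _ H)
    (theta_derive _ _ _ _ _ H)).
  apply (theta_derivative_pos _ _ _ _ _ H).
Qed.

Lemma cos_theta_decreasing lambda omega x z theta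
    (H : upward_solution lambda omega x z theta) (a b : R) :
  0 <= a -> a < b -> Rbar_lt b omega -> cos (theta b) < cos (theta a).
Proof.
  intros Ha Hab Hb; destruct (initial_values _ _ _ _ _ H) as [_ [_ Ht0]].
  assert (Hr : forall s, 0 <= s -> s <= b -> 0 <= theta s <= PI).
  { intros s [Hs | <-] Hsb.
    - destruct (theta_range _ _ _ _ _ H s Hs (Rbar_lt_below _ _ _ Hsb Hb)); lra.
    - rewrite Ht0; pose proof PI_RGT_0; lra. }
  pose proof (Hr a Ha ltac:(lra)); pose proof (Hr b ltac:(lra) ltac:(lra)).
  apply cos_decreasing_1; try lra.
  now apply (theta_increasing _ _ _ _ _ H).
Qed.

Lemma z_increasing lambda omega x z theta
    (H : upward_solution lambda omega x z theta) (a b : R) :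
  0 <= a -> a < b -> Rbar_lt b omega -> z a < z b.
Proof.
  apply (increasing_from_start z _ omega (z_right_continuous _ _ _ _ _ H)
    (z_derive _ _ _ _ _ H)).
  apply (up_sin _ _ _ _ _ H).
Qed.

(** * The behaviour at the end of a finite interval *)

(** The distance to the axis determined by the angle through conservation of energy. *)
Definition radius (lambda q : R) : R :=
  sqrt (2 * (potential lambda 1 - potential lambda (cos q))).

Lemma x_eq_radius lambda omega x z theta
    (H : upward_solution lambda omega x z theta) (s : R) :
  0 < s -> Rbar_lt s omega -> x s = radius lambda (theta s).
Proof.
  intros Hs Hso; pose proof (energy _ _ _ _ _ H s ltac:(lra) Hso) as HE.
  unfold radius; replace (2 * _) with (x s ^ 2) by lra.
  symmetry; apply sqrt_pow2; left; now apply (x_pos _ _ _ _ _ H).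
Qed.

Lemma potential_cos_continuous (lambda q : R) :
  0 < cos q + lambda -> continuous (fun t => potential lambda (cos t)) q.
Proof.
  intros Hq; apply (continuous_comp cos (potential lambda)); [apply continuous_cos | ].
  apply (ex_derive_continuous (potential lambda)); eexists; now apply potential_derive.
Qed.

Lemma radius_continuous (lambda q : R) :
  0 < cos q + lambda -> continuous (radius lambda) q.
Proof.
  intros Hq; apply (continuous_comp
    (fun t => 2 * (potential lambda 1 - potential lambda (cos t))) sqrt).
  - apply (continuous_scal_r 2 (fun t => potential lambda 1 - potential lambda (cos t))).
    apply (continuous_minus (fun _ => potential lambda 1)).
    + apply continuous_const.
    + now apply potential_cos_continuous.
  - apply continuous_sqrt.
Qed.

Lemma radius_derive (lambda q : R) :
  0 < cos q + lambda -> potential lambda (cos q) < potential lambda 1 ->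
  is_derive (radius lambda) q
    (cos q * sin q / ((cos q + lambda) * radius lambda q)).
Proof.
  intros Hq HG.
  assert (Hr : 0 < radius lambda q) by (apply sqrt_lt_R0; lra).
  apply is_derive_Reals.
  replace (cos q * sin q / ((cos q + lambda) * radius lambda q)) with
    (/ (2 * radius lambda q) * (2 * (0 - cos q / (cos q + lambda) * - sin q)))
    by (field; lra).
  apply (derivable_pt_lim_comp
    (fun t => 2 * (potential lambda 1 - potential lambda (cos t))) sqrt).
  - apply (derivable_pt_lim_scal (fun t => potential lambda 1 - potential lambda (cos t))).
    apply (derivable_pt_lim_minus (fun _ => potential lambda 1)
      (fun t => potential lambda (cos t))); [apply derivable_pt_lim_const | ].
    apply (derivable_pt_lim_comp cos (potential lambda)); [apply derivable_pt_lim_cos | ].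
    now apply is_derive_Reals, potential_derive.
  - apply derivable_pt_lim_sqrt; lra.
Qed.

(** The angle is monotone and bounded, and the distance to the axis is a continuous
    function of it.  The lower bound on [cos theta + lambda] is uniform on a bounded
    interval, which keeps the limit inside the domain of the potential. *)
Lemma endpoint_limits lambda w x z theta
    (H : upward_solution lambda (Finite w) x z theta) :
  exists Theta : R, Theta <= PI /\ (forall s, 0 < s < w -> theta s < Theta) /\
    filterlim theta (at_left w) (locally Theta) /\
    0 < cos Theta + lambda /\
    filterlim x (at_left w) (locally (radius lambda Theta)) /\
    potential lambda (cos Theta) <= potential lambda 1.
Proof.
  assert (Hw : 0 < w) by apply (up_omega _ _ _ _ _ H).
  pose proof (up_lambda _ _ _ _ _ H) as Hl.
  destruct (monotone_limit_left theta w PI Hw) as [Theta [HPI [Hle Hlim]]].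
  { intros a b Ha [Hab | ->] Hb; [ | lra].
    left; apply (theta_increasing _ _ _ _ _ H); simpl; lra. }
  { intros s Hs; left; apply (theta_range _ _ _ _ _ H); simpl; lra. }
  assert (Hnear : forall P : R -> Prop, (forall s, 0 < s < w -> P s) -> at_left w P).
  { intros P HP; exists (mkposreal w Hw); intros y Hy Hyw.
    apply Rabs_lt_between' in Hy; simpl in Hy; apply HP; lra. }
  assert (Hcos : filterlim (fun s => cos (theta s)) (at_left w) (locally (cos Theta)))
    by (apply filterlim_continuous; [apply at_left_proper_filter | exact Hlim
        | apply continuous_cos]).
  assert (Hu : 0 < cos Theta + lambda).
  { apply Rlt_le_trans with ((1 + lambda) * exp (- w ^ 2 / 2)).
    - apply Rmult_lt_0_compat; [lra | apply exp_pos].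
    - apply (filterlim_le (F := at_left w) (fun _ => (1 + lambda) * exp (- w ^ 2 / 2))
        (fun s => cos (theta s) + lambda)
        (Finite ((1 + lambda) * exp (- w ^ 2 / 2))) (Finite (cos Theta + lambda))).
      + apply Hnear; intros s Hs.
        apply Rle_trans
          with (2 := cos_plus_lambda_bound _ _ _ _ _ H s ltac:(lra) ltac:(simpl; lra)).
        apply Rmult_le_compat_l; [lra | ].
        left; apply exp_increasing; nra.
      + apply filterlim_const.
      + apply filterlim_Rplus; [apply at_left_proper_filter | exact Hcos
        | apply filterlim_const]. }
  exists Theta; repeat split; trivial.
  - intros s Hs; apply Rlt_le_trans with (theta ((s + w) / 2)).
    + apply (theta_increasing _ _ _ _ _ H); simpl; lra.
    + apply Hle; lra.
  - apply filterlim_ext_loc with (fun s => radius lambda (theta s)).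
    + apply Hnear; intros s Hs; symmetry; apply (x_eq_radius _ _ _ _ _ H); simpl; lra.
    + apply filterlim_continuous; [apply at_left_proper_filter | exact Hlim
        | now apply radius_continuous].
  - apply (filterlim_le (F := at_left w) (fun s => potential lambda (cos (theta s)))
        (fun _ => potential lambda 1)
        (Finite (potential lambda (cos Theta))) (Finite (potential lambda 1))).
    + apply Hnear; intros s Hs.
      pose proof (energy _ _ _ _ _ H s ltac:(lra) ltac:(simpl; lra)).
      pose proof (pow2_ge_0 (x s)); lra.
    + apply (filterlim_continuous (at_left w) theta (fun q => potential lambda (cos q)));
        [exact Hlim | now apply potential_cos_continuous].
    + apply filterlim_const.
Qed.

(** The hypothesis on the potential says that the limit of [x] is positive, so that the
    angle solves [theta' = F theta] with [F = radius * (cos + lambda) / sin] smooth and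
    positive near [Theta].  The solution of this equation through [(w, Theta)] carries
    the other two functions: [x] is the radius of the angle and [z] a primitive of its
    sine. *)
Lemma solution_extends lambda w x z theta (Theta : R)
    (H : upward_solution lambda (Finite w) x z theta)
    (HTheta : 0 < Theta < PI)
    (Hlt : forall s, 0 < s < w -> theta s < Theta)
    (Hlim : filterlim theta (at_left w) (locally Theta))
    (Hu : 0 < cos Theta + lambda)
    (HG : potential lambda (cos Theta) < potential lambda 1) :
  exists (b : R) (x' z' theta' : R -> R), w < b /\
    is_solution lambda b x' z' theta' /\
    forall s, dom w s -> x' s = x s /\ z' s = z s /\ theta' s = theta s.
Proof.
  assert (Hw : 0 < w) by apply (up_omega _ _ _ _ _ H).
  assert (Hloc : locally Theta (fun q => (0 < sin q /\ 0 < cos q + lambda) /\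
    0 < potential lambda 1 - potential lambda (cos q))).
  { repeat apply filter_and.
    - apply locally_positive; [apply continuous_sin | now apply sin_gt_0].
    - apply (locally_positive (fun q => cos q + lambda)); [ | exact Hu].
      apply (continuous_plus cos (fun _ => lambda)); [apply continuous_cos | ].
      apply continuous_const.
    - apply (locally_positive (fun q => potential lambda 1 - potential lambda (cos q)));
        [ | lra].
      apply (continuous_minus (fun _ => potential lambda 1)); [apply continuous_const | ].
      now apply potential_cos_continuous. }
  destruct Hloc as [eps Heps]; pose proof (cond_pos eps) as He.
  assert (Hgood : forall q, Theta - eps < q < Theta + eps ->
    0 < sin q /\ 0 < cos q + lambda /\ potential lambda (cos q) < potential lambda 1 /\
    0 < radius lambda q).
  { intros q Hq; destruct (Heps q) as [[H1 H2] H3]; [now apply Rabs_lt_between' | ].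
    repeat split; trivial; [lra | ].
    apply sqrt_lt_R0; lra. }
  set (F := fun q => radius lambda q * (cos q + lambda) / sin q).
  destruct (autonomous_ode_through F (Theta - eps) (Theta + eps) Theta w)
    as [a [b [T [Hab [HT Huniq]]]]]; [lra | | ].
  { intros q Hq; destruct (Hgood q Hq) as [H1 [H2 [H3 H4]]]; split.
    - assert (ex_derive (radius lambda) q) by (eexists; now apply radius_derive).
      apply (ex_derive_continuous F); unfold F; auto_derive.
      repeat split; trivial; lra.
    - apply Rdiv_lt_0_compat; [now apply Rmult_lt_0_compat | exact H1]. }
  (* The comparison with [T] is possible once the given angle has entered the window
     around [Theta] on which [F] is controlled. *)
  assert (Hc0 : exists c0, 0 <= c0 < w /\ forall s, c0 < s < w -> Theta - eps < theta s).
  { destruct (proj1 (filterlim_locally theta Theta) Hlim eps) as [r Hr].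
    exists (Rmax 0 (w - r)); pose proof (cond_pos r).
    split; [split; [apply Rmax_l | apply Rmax_lub_lt; lra] | ].
    intros s [Hs1 Hs2]; pose proof (Rmax_l 0 (w - r)); pose proof (Rmax_r 0 (w - r)).
    assert (Hb : ball Theta eps (theta s)).
    { apply Hr; [ | exact Hs2]; apply Rabs_lt_between'; lra. }
    apply Rabs_lt_between' in Hb; lra. }
  destruct Hc0 as [c0 [Hc0 Hth]].
  set (c := Rmax a c0).
  assert (Hc : a <= c /\ c0 <= c < w).
  { unfold c; repeat split; [apply Rmax_l | apply Rmax_r | apply Rmax_lub_lt; lra]. }
  assert (HTth : forall s, c < s < w -> theta s = T s).
  { apply (Huniq theta c); [lra | | exact Hlim].
    intros s Hs; pose proof (Hth s ltac:(lra)); pose proof (Hlt s ltac:(lra)).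
    split; [lra | ].
    unfold F; rewrite <- (x_eq_radius _ _ _ _ _ H) by (simpl; lra).
    apply (theta_derive _ _ _ _ _ H); simpl; lra. }
  assert (HTd : forall s, c < s < b -> is_derive T s (F (T s))) by (intros; apply HT; lra).
  destruct (primitive_through (fun s => sin (T s)) c b ((c + w) / 2) (z ((c + w) / 2)))
    as [Z [HZ0 HZ]]; [lra | | ].
  { intros s Hs; apply (continuous_comp T sin); [ | apply continuous_sin].
    apply (ex_derive_continuous T); eexists; now apply HTd. }
  assert (HZz : forall s, c < s < w -> Z s = z s).
  { assert (Hconst : forall s t, c < s -> s <= t -> t < w -> Z s - z s = Z t - z t).
    { intros s t Hs [Hst | ->] Ht; [ | reflexivity].
      destruct (MVT_cor2 (fun t => Z t - z t) (fun _ => 0) s t Hst) as [e [Hee _]].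
      - intros e Hee.
        replace 0 with (sin (T e) - sin (theta e)) by (rewrite HTth by lra; ring).
        apply (derivable_pt_lim_minus Z z); apply is_derive_Reals; [apply HZ; lra | ].
        apply (z_derive _ _ _ _ _ H); simpl; lra.
      - lra. }
    intros s Hs; destruct (Rle_lt_dec s ((c + w) / 2)).
    - pose proof (Hconst s ((c + w) / 2)); lra.
    - pose proof (Hconst ((c + w) / 2) s); lra. }
  exists b.
  destruct (solution_glue lambda c w b x z theta (fun s => radius lambda (T s)) Z T)
    as [x' [z' [t' [Hs1 Hs2]]]].
  - apply (up_solution _ _ _ _ _ H).
  - lra.
  - lra.
  - intros s Hs; apply Hgood, HT; lra.
  - intros s Hs; apply Rgt_not_eq, Hgood, HT; lra.
  - intros s Hs; destruct (Hgood (T s)) as [H1 [H2 [H3 H4]]]; [apply HT; lra | ].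
    apply is_derive_Reals.
    replace (cos (T s)) with
      (cos (T s) * sin (T s) / ((cos (T s) + lambda) * radius lambda (T s)) * F (T s))
      by (unfold F; field; lra).
    apply (derivable_pt_lim_comp T (radius lambda)); apply is_derive_Reals.
    + now apply HTd.
    + now apply radius_derive.
  - exact HZ.
  - intros s Hs; destruct (Hgood (T s)) as [H1 _]; [apply HT; lra | ].
    replace (radius lambda (T s) * (cos (T s) / sin (T s))
      + lambda * (radius lambda (T s) / sin (T s)))
      with (F (T s)) by (unfold F; field; lra).
    now apply HTd.
  - intros s Hs; rewrite <- (HTth s Hs); repeat split; [ | now apply HZz].
    symmetry; apply (x_eq_radius _ _ _ _ _ H); simpl; lra.
  - exists x', z', t'; split; [lra | now split].
Qed.

(** With [t = 1 / lambda] this is [2 t < ln (1 + t) - ln (1 - t)], whose two sides agree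
    at [t = 0] and have the derivatives [2 < 2 / (1 - t^2)].  It says that the orbit
    returns to the axis before the tangent points straight back at it. *)
Lemma potential_minus_one (lambda : R) :
  1 < lambda -> potential lambda 1 < potential lambda (-1).
Proof.
  intros Hl.
  set (g := fun t => ln (1 + t) - ln (1 - t) - 2 * t).
  assert (Hg : g 0 < g (/ lambda)).
  { assert (Hi : 0 < / lambda < 1).
    { split; [apply Rinv_0_lt_compat; lra | ].
      rewrite <- Rinv_1; apply Rinv_lt_contravar; lra. }
    assert (Hd : forall t, -1 < t < 1 -> is_derive g t (2 * t ^ 2 / (1 - t ^ 2))).
    { intros t Ht; unfold g; auto_derive; [lra | field; nra]. }
    apply (increasing_from_start g (fun t => 2 * t ^ 2 / (1 - t ^ 2)) 1); simpl; try lra.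
    - eapply filterlim_filter_le_1; [apply filter_le_within | ].
      apply (ex_derive_continuous g); eexists; apply Hd; lra.
    - intros t Ht Ht1; apply Hd; lra.
    - intros t Ht Ht1; apply Rdiv_lt_0_compat; nra. }
  unfold g in Hg.
  replace (1 + / lambda) with ((1 + lambda) * / lambda) in Hg by (field; lra).
  replace (1 - / lambda) with ((-1 + lambda) * / lambda) in Hg by (field; lra).
  assert (0 < / lambda) by (apply Rinv_0_lt_compat; lra).
  rewrite !ln_mult in Hg by lra.
  rewrite Rplus_0_r, Rminus_0_r, ln_1 in Hg.
  assert (2 < lambda * (ln (1 + lambda) - ln (-1 + lambda))).
  { apply Rmult_lt_reg_l with (/ lambda); [lra | ].
    rewrite <- Rmult_assoc, Rinv_l by lra; lra. }
  unfold potential; lra.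
Qed.

Definition extendable (lambda : R) (omega : Rbar) (x z theta : R -> R) : Prop :=
  exists (omega' : Rbar) (x' z' theta' : R -> R),
    Rbar_lt omega omega' /\
    is_solution lambda omega' x' z' theta' /\
    forall s : R, dom omega s -> x' s = x s /\ z' s = z s /\ theta' s = theta s.

(** The angle [PI] has cosine [-1], which is in the domain of the potential only if
    [lambda > 1], and there the potential exceeds its initial value. *)
Lemma endpoint_angle_lt_PI (lambda Theta : R) :
  0 < cos Theta + lambda -> potential lambda (cos Theta) <= potential lambda 1 ->
  Theta <= PI -> Theta < PI.
Proof.
  intros Hu HG [HPI | ->]; [exact HPI | exfalso].
  rewrite cos_PI in *; pose proof (potential_minus_one lambda); lra.
Qed.

(** The only obstruction to continuing the curve is that it meets the axis; it does so
    with [sin Theta > 0], that is, not orthogonally. *)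
Lemma maximal_endpoint lambda w x z theta
    (H : upward_solution lambda (Finite w) x z theta)
    (Hmax : ~ extendable lambda (Finite w) x z theta) :
  exists Theta : R, 0 < Theta < PI /\
    filterlim theta (at_left w) (locally Theta) /\
    filterlim x (at_left w) (locally 0).
Proof.
  assert (Hw : 0 < w) by apply (up_omega _ _ _ _ _ H).
  destruct (endpoint_limits _ _ _ _ _ H) as [Theta [HPI [Hlt [Hth [Hu [Hx HG]]]]]].
  assert (HTheta : 0 < Theta < PI).
  { split; [ | now apply endpoint_angle_lt_PI with lambda].
    pose proof (Hlt (w / 2) ltac:(lra)).
    pose proof (theta_range _ _ _ _ _ H (w / 2) ltac:(lra) ltac:(simpl; lra)); lra. }
  exists Theta; split; [exact HTheta | split; [exact Hth | ]].
  destruct HG as [HG | HG].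
  - exfalso; apply Hmax.
    destruct (solution_extends _ _ _ _ _ Theta H HTheta Hlt Hth Hu HG)
      as [b [x' [z' [t' [Hb Hext]]]]].
    now exists (Finite b), x', z', t'.
  - replace 0 with (radius lambda Theta); [exact Hx | ].
    unfold radius; rewrite HG, Rminus_diag_eq, Rmult_0_r by reflexivity; apply sqrt_0.
Qed.

(** * Positive lambda: the curve closes up *)

(** On an infinite interval [x] is positive and, once [cos theta] is negative, decreases
    at least linearly; so [cos theta >= 0] throughout.  Then [x >= x 1] after time [1],
    and [cos theta] itself decreases at least linearly, which is absurd. *)
Lemma lifetime_finite lambda omega x z theta
    (H : upward_solution lambda omega x z theta) :
  0 < lambda -> omega <> p_infty.
Proof.
  intros Hl ->.
  assert (Hdx : forall s, 0 < s -> is_derive x s (cos (theta s)))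
    by (intros s Hs; now apply (x_derive _ _ _ _ _ H)).
  assert (Hc : forall s, 0 < s -> 0 <= cos (theta s)).
  { intros s Hs; apply Rnot_lt_le; intros Hneg.
    (* At the time [t] the linear upper bound on [x], of slope [- k], has come down to [0]. *)
    set (k := - cos (theta s)).
    set (t := s + x s / k).
    pose proof (x_pos _ _ _ _ _ H s Hs I) as Hxs.
    assert (Hk : 0 < k) by (unfold k; lra).
    assert (Hst : s < t) by (unfold t; assert (0 < x s / k) by (now apply Rdiv_lt_0_compat); lra).
    pose proof (x_pos _ _ _ _ _ H t ltac:(lra) I) as Hxt.
    assert (Hgl : - x s + k * (t - s) <= - x t).
    { apply (growth_linear (fun r => - x r) (fun r => - cos (theta r)) k s); try lra.
      - intros r Hr; apply (is_derive_opp x r (cos (theta r))), Hdx; lra.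
      - intros r [Hr | ->]; [ | unfold k; lra].
        pose proof (cos_theta_decreasing _ _ _ _ _ H s r ltac:(lra) Hr I); unfold k; lra. }
    replace (k * (t - s)) with (x s) in Hgl by (unfold t; field; lra).
    lra. }
  pose proof (x_pos _ _ _ _ _ H 1 ltac:(lra) I) as Hx1.
  assert (Hx : forall s, 1 <= s -> x 1 <= x s).
  { intros s Hs; pose proof (growth_linear x (fun r => cos (theta r)) 0 1) as Hgl.
    enough (x 1 + 0 * (s - 1) <= x s) by lra; apply Hgl; trivial.
    - intros r Hr; apply Hdx; lra.
    - intros r Hr; apply Hc; lra. }
  assert (Hk : 0 < x 1 * lambda) by now apply Rmult_lt_0_compat.
  (* By the time [t] the cosine has lost at least [2], more than [cos (theta 1) <= 1] permits. *)
  set (t := 1 + 2 / (x 1 * lambda)).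
  assert (Ht : 1 < t).
  { unfold t; assert (0 < 2 / (x 1 * lambda)) by (apply Rdiv_lt_0_compat; lra); lra. }
  assert (Hgl : - cos (theta 1) + (x 1 * lambda) * (t - 1) <= - cos (theta t)).
  { apply (growth_linear (fun r => - cos (theta r))
      (fun r => x r * (cos (theta r) + lambda)) (x 1 * lambda) 1); try lra.
    - intros r Hr; rewrite <- (Ropp_involutive (x r * (cos (theta r) + lambda))).
      apply (is_derive_opp (fun r => cos (theta r))).
      apply (cos_theta_derive _ _ _ _ _ H); [lra | exact I].
    - intros r Hr; pose proof (Hx r Hr); pose proof (Hc r ltac:(lra)).
      apply Rmult_le_compat; lra. }
  replace (x 1 * lambda * (t - 1)) with 2 in Hgl by (unfold t; field; lra).
  pose proof (COS_bound (theta 1)); pose proof (Hc t ltac:(lra)); lra.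
Qed.

Lemma positive_lambda_case lambda omega x z theta
    (H : upward_solution lambda omega x z theta)
    (Hmax : ~ extendable lambda omega x z theta) :
  0 < lambda ->
  exists w : R, omega = Finite w /\
    meets_z_axis_at x w /\ ~ orthogonal_at theta w /\
    (forall s : R, dom omega s -> x s < sqrt 2).
Proof.
  intros Hl; pose proof (up_omega _ _ _ _ _ H) as Hw.
  destruct omega as [w | | ]; [ | now destruct (lifetime_finite _ _ _ _ _ H Hl) | easy].
  simpl in Hw; exists w; split; [reflexivity | ].
  destruct (maximal_endpoint _ _ _ _ _ H Hmax) as [Theta [HTheta [Hth Hx]]].
  split; [exact Hx | split].
  - intros Horth.
    assert (Hs : filterlim (fun s => sin (theta s)) (at_left w) (locally (sin Theta)))
      by (apply filterlim_continuous; [apply at_left_proper_filter | exact Hth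
          | apply continuous_sin]).
    pose proof (filterlim_locally_unique (F := at_left w) _ _ _ Hs Horth) as H0.
    pose proof (sin_gt_0 Theta); lra.
  - intros s [Hs Hso]; pose proof (energy _ _ _ _ _ H s Hs Hso) as HE.
    pose proof (cos_plus_lambda_pos _ _ _ _ _ H s Hs Hso) as Hup.
    set (p := cos (theta s)) in *.
    (* The minimum of the potential is at [p = 0], by [ln y <= y - 1]. *)
    assert (HG0 : potential lambda 0 <= potential lambda p).
    { assert (Hln : ln ((p + lambda) / lambda) <= p / lambda).
      { rewrite <- (ln_exp (p / lambda)); apply ln_le.
        - now apply Rdiv_lt_0_compat.
        - pose proof (exp_ineq1_le (p / lambda)).
          replace ((p + lambda) / lambda) with (1 + p / lambda) by (field; lra); lra. }
      rewrite ln_div in Hln by lra.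
      apply (Rmult_le_compat_l lambda) in Hln; [ | lra].
      replace (lambda * (p / lambda)) with p in Hln by (field; lra).
      unfold potential; rewrite Rplus_0_l; lra. }
    assert (Hln : ln lambda < ln (1 + lambda)) by (apply ln_increasing; lra).
    unfold potential in HG0, HE; rewrite Rplus_0_l in HG0.
    rewrite <- (sqrt_pow2 (x s)).
    + apply sqrt_lt_1_alt; split; [apply pow2_ge_0 | nra].
    + destruct Hs as [Hs | <-]; [left; now apply (x_pos _ _ _ _ _ H) | ].
      destruct (initial_values _ _ _ _ _ H); lra.
Qed.

(** * Nonpositive lambda: the curve has infinite length *)

Lemma cos_theta_pos lambda omega x z theta
    (H : upward_solution lambda omega x z theta) (s : R) :
  lambda <= 0 -> 0 <= s -> Rbar_lt s omega -> 0 < cos (theta s).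
Proof.
  intros Hl Hs Hso; pose proof (cos_plus_lambda_pos _ _ _ _ _ H s Hs Hso); lra.
Qed.

Lemma x_increasing lambda omega x z theta
    (H : upward_solution lambda omega x z theta) (Hl : lambda <= 0) (a b : R) :
  0 <= a -> a < b -> Rbar_lt b omega -> x a < x b.
Proof.
  apply (increasing_from_start x _ omega (x_right_continuous _ _ _ _ _ H)
    (x_derive _ _ _ _ _ H)).
  intros s Hs Hso; apply (cos_theta_pos _ _ _ _ _ H); trivial; lra.
Qed.

(** The distance to the axis increases, whereas a maximal curve of finite length would
    end on the axis. *)
Lemma lifetime_infinite lambda omega x z theta
    (H : upward_solution lambda omega x z theta)
    (Hmax : ~ extendable lambda omega x z theta) :
  lambda <= 0 -> omega = p_infty.
Proof.
  intros Hl; pose proof (up_omega _ _ _ _ _ H) as Hw.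
  destruct omega as [w | | ]; [exfalso | reflexivity | easy]; simpl in Hw.
  destruct (maximal_endpoint _ _ _ _ _ H Hmax) as [Theta [_ [_ Hx]]].
  assert (Hle : x (w / 2) <= 0).
  { apply (filterlim_le (F := at_left w) (fun _ => x (w / 2)) x
      (Finite (x (w / 2))) (Finite 0)); trivial.
    - exists (mkposreal (w / 2) ltac:(lra)); intros y Hy Hyw.
      apply Rabs_lt_between' in Hy; simpl in Hy.
      left; apply (x_increasing _ _ _ _ _ H Hl); simpl; lra.
    - apply filterlim_const. }
  pose proof (x_pos _ _ _ _ _ H (w / 2) ltac:(lra) ltac:(simpl; lra)); lra.
Qed.

(** For [u = cos theta + lambda] the equation [u' = - x u] gives [(1 / u)' = x / u], and
    this is at least [x 1 / (1 + lambda)] after time [1]; so [1 / u] tends to infinity. *)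
Lemma cos_theta_limit lambda x z theta
    (H : upward_solution lambda p_infty x z theta) :
  lambda <= 0 -> is_lim (fun s => cos (theta s)) p_infty (- lambda).
Proof.
  intros Hl.
  assert (Hu : forall s, 0 <= s -> 0 < cos (theta s) + lambda)
    by (intros s Hs; now apply (cos_plus_lambda_pos _ _ _ _ _ H)).
  pose proof (up_lambda _ _ _ _ _ H) as Hl1.
  pose proof (x_pos _ _ _ _ _ H 1 ltac:(lra) I) as Hx1.
  assert (Hinv : is_lim (fun s => / (cos (theta s) + lambda)) p_infty p_infty).
  { apply (growth_to_infinity _ (fun s => x s / (cos (theta s) + lambda))
      (x 1 / (1 + lambda)) 1).
    - apply Rdiv_lt_0_compat; lra.
    - intros s Hs; pose proof (Hu s ltac:(lra)) as Hus.
      apply is_derive_Reals.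
      replace (x s / (cos (theta s) + lambda)) with
        (- / (cos (theta s) + lambda) ^ 2 * - (x s * (cos (theta s) + lambda)))
        by (field; lra).
      apply (derivable_pt_lim_comp (fun t => cos (theta t)) (fun y => / (y + lambda))).
      + apply is_derive_Reals, (cos_theta_derive _ _ _ _ _ H); [lra | exact I].
      + apply is_derive_Reals; auto_derive; [lra | field; lra].
    - intros s Hs; pose proof (Hu s ltac:(lra)) as Hus.
      pose proof (COS_bound (theta s)).
      apply Rmult_le_compat; try lra.
      + left; apply Rinv_0_lt_compat; lra.
      + destruct Hs as [Hs | <-]; [ | lra].
        left; apply (x_increasing _ _ _ _ _ H Hl); simpl; trivial; lra.
      + apply Rinv_le_contravar; lra. }
  assert (Hz : is_lim (fun s => / (/ (cos (theta s) + lambda)) - lambda) p_infty (- lambda)).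
  { replace (Finite (- lambda)) with (Finite (0 - lambda)) by (f_equal; ring).
    apply (is_lim_minus' _ (fun _ => lambda)); [ | apply is_lim_const].
    apply (is_lim_inv _ _ p_infty Hinv); discriminate. }
  apply is_lim_ext_loc with (2 := Hz).
  exists 0; intros s Hs; rewrite Rinv_inv; ring.
Qed.

(** Positivity of the cosine confines [theta] to [(0, PI / 2)], where the sine increases;
    the slope of [z] is therefore at least [sin (theta 1)] after time [1]. *)
Lemma z_limit lambda x z theta (H : upward_solution lambda p_infty x z theta) :
  lambda <= 0 -> is_lim z p_infty p_infty.
Proof.
  intros Hl.
  apply (growth_to_infinity z (fun s => sin (theta s)) (sin (theta 1)) 1).
  - apply (up_sin _ _ _ _ _ H); [lra | exact I].
  - intros s Hs; apply (z_derive _ _ _ _ _ H); [lra | exact I].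
  - assert (Hq : forall s, 0 < s -> 0 < theta s < PI / 2).
    { intros s Hs; pose proof (theta_range _ _ _ _ _ H s Hs I).
      pose proof (cos_theta_pos _ _ _ _ _ H s Hl ltac:(lra) I).
      split; [lra | ]; apply Rnot_le_lt; intros Hge.
      pose proof (cos_le_0 (theta s) Hge ltac:(lra)); lra. }
    intros s [Hs | <-]; [ | lra].
    pose proof (Hq 1 ltac:(lra)); pose proof (Hq s ltac:(lra)).
    left; apply sin_increasing_1; try lra.
    apply (theta_increasing _ _ _ _ _ H); simpl; trivial; lra.
Qed.

(** For [lambda = 0] the energy identity reads [x^2 = 2 (1 - cos theta)]. *)
Lemma zero_lambda_asymptote x z theta (H : upward_solution 0 p_infty x z theta) :
  is_lim x p_infty (sqrt 2).
Proof.
  pose proof (cos_theta_limit _ _ _ _ H ltac:(lra)) as Hc.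
  replace (sqrt 2) with (sqrt (2 * (1 - - 0))) by (f_equal; ring).
  apply is_lim_ext_loc with (fun s => sqrt (2 * (1 - cos (theta s)))).
  - exists 0; intros s Hs; rewrite (x_eq_radius _ _ _ _ _ H s Hs I).
    unfold radius, potential; f_equal; ring.
  - apply (is_lim_comp_continuous _ (fun y => sqrt (2 * (1 - y))) _ _ Hc).
    apply (continuous_comp (fun y => 2 * (1 - y)) sqrt); [ | apply continuous_sqrt].
    apply (ex_derive_continuous (fun y => 2 * (1 - y))); auto_derive; exact I.
Qed.

Lemma x_ge_minus_lambda_arclength lambda x z theta
    (H : upward_solution lambda p_infty x z theta) (s : R) :
  0 <= s -> - lambda * s <= x s.
Proof.
  intros Hs.
  enough (x 0 + lambda * 0 <= x s + lambda * s) by (destruct (initial_values _ _ _ _ _ H); lra).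
  apply (nondecreasing_from_start (fun t => x t + lambda * t)
    (fun t => cos (theta t) + lambda) p_infty); trivial; try lra; [ | | | exact I].
  - apply filterlim_Rplus; [apply at_right_proper_filter
      | now apply (x_right_continuous _ _ _ _ _ H) | ].
    apply filterlim_Rmult; [apply at_right_proper_filter | apply filterlim_const
      | apply at_right_id].
  - intros t Ht _; apply is_derive_Reals.
    apply (derivable_pt_lim_plus x (fun t => lambda * t)).
    + apply is_derive_Reals, (x_derive _ _ _ _ _ H); [exact Ht | exact I].
    + apply is_derive_Reals; auto_derive; [exact I | ring].
  - intros t Ht _; left; apply (cos_plus_lambda_pos _ _ _ _ _ H); simpl; trivial; lra.
Qed.

Lemma negative_lambda_x_limit lambda x z theta
    (H : upward_solution lambda p_infty x z theta) :
  lambda < 0 -> is_lim x p_infty p_infty.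
Proof.
  intros Hl; apply (growth_to_infinity x (fun s => cos (theta s)) (- lambda) 1); [lra | | ].
  - intros s Hs; apply (x_derive _ _ _ _ _ H); [lra | exact I].
  - intros s Hs; pose proof (cos_plus_lambda_pos _ _ _ _ _ H s ltac:(lra) I); lra.
Qed.

(** The angle stays below [acos (- lambda)] because its cosine stays above [- lambda],
    and it exceeds any smaller angle once its cosine has come close enough to the limit. *)
Lemma negative_lambda_theta_limit lambda x z theta
    (H : upward_solution lambda p_infty x z theta) :
  lambda < 0 -> is_lim theta p_infty (acos (- lambda)).
Proof.
  intros Hl; pose proof (up_lambda _ _ _ _ _ H) as Hl1.
  set (A := acos (- lambda)).
  assert (HA : cos A = - lambda) by (apply cos_acos; lra).
  assert (HAb : 0 <= A <= PI) by apply acos_bound.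
  assert (Hub : forall s, 0 < s -> theta s < A).
  { intros s Hs; apply Rnot_le_lt; intros Hge.
    pose proof (theta_range _ _ _ _ _ H s Hs I).
    pose proof (cos_plus_lambda_pos _ _ _ _ _ H s ltac:(lra) I).
    pose proof (cos_decr_1 A (theta s)); lra. }
  pose proof (cos_theta_limit _ _ _ _ H ltac:(lra)) as Hc.
  apply is_lim_spec; intros eps; pose proof (cond_pos eps) as He.
  set (B := Rmax 0 (A - eps)).
  pose proof (Rmax_l 0 (A - eps)); pose proof (Rmax_r 0 (A - eps)).
  destruct (Req_dec A 0) as [HA0 | HA0].
  { pose proof (Hub 1 ltac:(lra)).
    pose proof (theta_range _ _ _ _ _ H 1 ltac:(lra) I); lra. }
  assert (HB : 0 <= B < A) by (unfold B; split; [assumption | apply Rmax_lub_lt; lra]).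
  pose proof (cos_decreasing_1 B A ltac:(lra) ltac:(lra) ltac:(lra) ltac:(lra)) as HBA.
  specialize (HBA ltac:(lra)); rewrite HA in HBA.
  apply is_lim_spec in Hc; destruct (Hc (mkposreal (cos B - - lambda) ltac:(lra))) as [M HM].
  exists (Rmax 0 M); intros s Hs.
  pose proof (Rmax_l 0 M); pose proof (Rmax_r 0 M).
  specialize (HM s ltac:(lra)); apply Rabs_lt_between' in HM; simpl in HM.
  assert (Hs0 : 0 < s) by lra.
  pose proof (theta_range _ _ _ _ _ H s Hs0 I); pose proof (Hub s Hs0).
  assert (B < theta s).
  { apply Rnot_le_lt; intros Hge; pose proof (cos_decr_1 (theta s) B); lra. }
  apply Rabs_lt_between'; unfold B in *; lra.
Qed.

(** The graph function is [z] composed with the inverse of [x], which increases from [0] to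
    infinity; the bounds [- lambda s <= x s <= s] provide explicit brackets for solving
    [x s = |a|]. *)
Lemma negative_lambda_graph lambda x z theta
    (H : upward_solution lambda p_infty x z theta) :
  lambda < 0 -> entire_graph x z.
Proof.
  intros Hl; destruct (initial_values _ _ _ _ _ H) as [Hx0 _].
  assert (Hinv : forall a, {s | 0 <= s /\ x s = Rabs a}).
  { intros a; destruct (Req_EM_T (Rabs a) 0) as [Ha | Ha].
    - exists 0; split; lra.
    - assert (Hpos : 0 < Rabs a) by (pose proof (Rabs_pos a); lra).
      set (s1 := Rabs a / 2); set (s2 := Rabs a + Rabs a / - lambda).
      assert (Hq : 0 < Rabs a / - lambda) by (apply Rdiv_lt_0_compat; lra).
      assert (Hs1 : 0 < s1 < s2) by (unfold s1, s2; lra).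
      destruct (Ranalysis5.IVT_interv (fun s => x s - Rabs a) s1 s2) as [s [Hs1' Hs2']].
      + intros s Hs; apply continuity_pt_minus; [ | now apply continuity_pt_const].
        apply continuity_pt_filterlim, (ex_derive_continuous x); eexists.
        apply (x_derive _ _ _ _ _ H); [lra | exact I].
      + lra.
      + pose proof (x_le_arclength _ _ _ _ _ H s1 ltac:(lra) I); unfold s1 in *; lra.
      + pose proof (x_ge_minus_lambda_arclength _ _ _ _ H s2 ltac:(lra)) as Hlin.
        assert (- lambda * s2 = - lambda * Rabs a + Rabs a) by (unfold s2; field; lra).
        nra.
      + exists s; split; lra. }
  exists (fun a => z (proj1_sig (Hinv a))); intros a b.
  destruct (Hinv a) as [s [Hs Hxs]]; simpl; split.
  - intros ->; exists s; repeat split; trivial.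
    destruct (Rle_dec 0 a) as [Ha | Ha].
    + left; rewrite Hxs, Rabs_right; lra.
    + right; rewrite Hxs, Rabs_left; lra.
  - intros [t [Ht [Hax ->]]]; f_equal.
    assert (Hxt : x t = Rabs a).
    { assert (0 <= x t).
      { destruct Ht as [Ht | <-]; [left; apply (x_pos _ _ _ _ _ H); trivial; exact I | lra]. }
      destruct Hax as [-> | ->]; [ | rewrite Rabs_Ropp]; rewrite Rabs_right; lra. }
    destruct (Rtotal_order t s) as [Hts | [Hts | Hts]]; [ | exact Hts | ].
    + pose proof (x_increasing _ _ _ _ _ H ltac:(lra) t s Ht Hts I); lra.
    + pose proof (x_increasing _ _ _ _ _ H ltac:(lra) s t Hs Hts I); lra.
Qed.

(** * Convexity, including the point on the axis *)

Lemma one_minus_cos_le (t : R) : 0 <= t -> 1 - cos t <= t ^ 2 / 2.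
Proof.
  intros [Ht | <-]; [ | rewrite cos_0; lra].
  replace t with (2 * (t / 2)) at 1 by field; rewrite cos_2a_sin.
  pose proof (SIN_bound (t / 2)).
  pose proof (sin_lt_x (t / 2) ltac:(lra)).
  assert (- (t / 2) <= sin (t / 2)).
  { destruct (Rle_lt_dec t 2).
    - left; apply Rlt_trans with 0; [lra | apply sin_gt_0; [lra | ]].
      pose proof PI2_1; unfold PI2 in *; lra.
    - lra. }
  nra.
Qed.

(** The formula for [theta'] is [0 / 0] at the axis.  Instead, near [0] one has
    [x >= s / 2] and [cos theta + lambda >= (1 + lambda) / 2], so
    [(1 - cos theta)' = x (cos theta + lambda) >= k s] with [k = (1 + lambda) / 4], and
    [theta^2 >= 2 (1 - cos theta) >= k s^2]. *)
Lemma initial_slope lambda omega x z theta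
    (H : upward_solution lambda omega x z theta) :
  exists k r, 0 < k /\ 0 < r /\ forall s, 0 < s < r -> k * s <= theta s.
Proof.
  pose proof (up_lambda _ _ _ _ _ H) as Hl.
  destruct (initial_values _ _ _ _ _ H) as [Hx0 [_ Ht0]].
  destruct (Rbar_lt_dense 0 omega (up_omega _ _ _ _ _ H)) as [t0 [Ht00 Ht0o]].
  destruct (at_right_positive (fun t => cos (theta t) + - (1 / 2)) (1 + - (1 / 2)))
    as [r1 [Hr1 Hcos]]; [ | lra | ].
  { apply filterlim_Rplus; [apply at_right_proper_filter | | apply filterlim_const].
    replace 1 with (cos (theta 0)) at 1 by (rewrite Ht0; apply cos_0).
    now apply (cos_right_continuous _ _ _ _ _ H). }
  set (r := Rmin t0 (Rmin r1 1)).
  assert (Hr : 0 < r /\ r <= t0 /\ r <= r1 /\ r <= 1).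
  { unfold r; pose proof (Rmin_l t0 (Rmin r1 1)); pose proof (Rmin_r t0 (Rmin r1 1)).
    pose proof (Rmin_l r1 1); pose proof (Rmin_r r1 1).
    repeat split; try lra; repeat apply Rmin_glb_lt; lra. }
  destruct Hr as [Hr [Hrt [Hrr Hr1']]].
  assert (Hin : forall s, s < r -> Rbar_lt s omega)
    by (intros s Hs; apply Rbar_lt_below with (2 := Ht0o); lra).
  assert (Hx : forall s, 0 < s < r -> s / 2 <= x s).
  { intros s Hs.
    enough (x 0 + - / 2 * 0 <= x s + - / 2 * s) by lra.
    apply (nondecreasing_from_start (fun t => x t + - / 2 * t)
      (fun t => cos (theta t) + - (1 / 2)) r); simpl; try lra.
    - apply filterlim_Rplus; [apply at_right_proper_filter
        | now apply (x_right_continuous _ _ _ _ _ H) | ].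
      apply filterlim_Rmult; [apply at_right_proper_filter | apply filterlim_const
        | apply at_right_id].
    - intros t Ht Htr; apply is_derive_Reals.
      apply (derivable_pt_lim_plus x (fun t => - / 2 * t)).
      + apply is_derive_Reals, (x_derive _ _ _ _ _ H); auto.
      + apply is_derive_Reals; auto_derive; [exact I | field].
    - intros t Ht Htr; left; apply Hcos; lra. }
  set (k := (1 + lambda) / 4).
  assert (Hk : 0 < k) by (unfold k; lra).
  assert (Hc : forall s, 0 < s < r -> k * s ^ 2 / 2 <= 1 - cos (theta s)).
  { intros s Hs.
    enough (- cos (theta 0) + - (k * 0 ^ 2 / 2) <= - cos (theta s) + - (k * s ^ 2 / 2))
      by (rewrite Ht0, cos_0 in *; lra).
    apply (nondecreasing_from_start (fun t => - cos (theta t) + - (k * t ^ 2 / 2))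
      (fun t => x t * (cos (theta t) + lambda) + - (k * t)) r); simpl; try lra.
    - apply filterlim_Rplus; [apply at_right_proper_filter | | ].
      + apply (filterlim_continuous (at_right 0) (fun t => cos (theta t)) Ropp).
        * now apply (cos_right_continuous _ _ _ _ _ H).
        * apply (ex_derive_continuous Ropp); auto_derive; exact I.
      + apply (filterlim_continuous (at_right 0) (fun t => t)
          (fun t => - (k * t ^ 2 / 2))); [apply at_right_id | ].
        apply (ex_derive_continuous (fun t => - (k * t ^ 2 / 2))); auto_derive; exact I.
    - intros t Ht Htr; apply is_derive_Reals.
      apply (derivable_pt_lim_plus (fun t => - cos (theta t)) (fun t => - (k * t ^ 2 / 2))).
      + rewrite <- (Ropp_involutive (x t * (cos (theta t) + lambda))).
        apply (derivable_pt_lim_opp (fun t => cos (theta t))).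
        apply is_derive_Reals, (cos_theta_derive _ _ _ _ _ H); auto.
      + apply is_derive_Reals; auto_derive; [exact I | field].
    - intros t Ht Htr; pose proof (Hx t ltac:(lra)).
      assert (Hu : (1 + lambda) / 2 <= cos (theta t) + lambda).
      { apply Rle_trans with (2 := cos_plus_lambda_bound _ _ _ _ _ H t ltac:(lra) (Hin t Htr)).
        assert (t ^ 2 <= 1) by nra.
        assert (1 / 2 <= exp (- t ^ 2 / 2)).
        { apply Rle_trans with (2 := exp_ineq1_le (- t ^ 2 / 2)); lra. }
        unfold Rdiv at 1; apply Rmult_le_compat_l; lra. }
      assert (t / 2 * ((1 + lambda) / 2) <= x t * (cos (theta t) + lambda))
        by (apply Rmult_le_compat; lra).
      unfold k; lra. }
  exists (sqrt k), r; split; [now apply sqrt_lt_R0 | split; [exact Hr | ]].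
  intros s Hs; pose proof (theta_range _ _ _ _ _ H s ltac:(lra) ltac:(apply Hin; lra)).
  pose proof (one_minus_cos_le (theta s) ltac:(lra)); pose proof (Hc s Hs).
  apply Rsqr_incr_0; try lra.
  - rewrite Rsqr_mult, Rsqr_sqrt, !Rsqr_pow2 by lra; lra.
  - apply Rmult_le_pos; [apply sqrt_pos | lra].
Qed.

Lemma upward_convex lambda omega x z theta
    (H : upward_solution lambda omega x z theta) :
  exists kappa : R -> R, forall s, dom omega s ->
    D_in theta kappa (dom omega) s /\ 0 < kappa s.
Proof.
  destruct (sol_C1_theta _ _ _ _ _ (up_solution _ _ _ _ _ H)) as [d Hd].
  exists d; intros s Hs; split; [now apply Hd | ].
  destruct (Hd s Hs) as [HD _]; destruct Hs as [[Hs | <-] Hso].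
  - apply D_in_interior in HD; trivial.
    rewrite <- (is_derive_unique _ _ _ HD).
    rewrite (is_derive_unique _ _ _ (theta_derive _ _ _ _ _ H s Hs Hso)).
    now apply (theta_derivative_pos _ _ _ _ _ H).
  - destruct (initial_slope _ _ _ _ _ H) as [k [r [Hk [Hr Hslope]]]].
    apply (limit1_in_at_right _ omega _ Hso) in HD.
    apply Rlt_le_trans with (1 := Hk).
    apply (filterlim_le (F := at_right 0) (fun _ => k)
      (fun t => (theta t - theta 0) / (t - 0)) (Finite k) (Finite (d 0))); trivial.
    + exists (mkposreal r Hr); intros t Ht Ht0; apply Rabs_lt_between' in Ht; simpl in Ht.
      destruct (initial_values _ _ _ _ _ H) as [_ [_ ->]].
      rewrite !Rminus_0_r; apply Rmult_le_reg_r with t; [exact Ht0 | ].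
      unfold Rdiv; rewrite Rmult_assoc, Rinv_l, Rmult_1_r by lra.
      apply Hslope; lra.
    + apply filterlim_const.
Qed.

(** * Classification and reflection *)

Lemma upward_classification lambda omega x z theta
    (H : upward_solution lambda omega x z theta)
    (Hmax : ~ extendable lambda omega x z theta) :
  (0 < lambda ->
     exists w : R, omega = Finite w /\
       meets_z_axis_at x w /\
       ~ orthogonal_at theta w /\
       (forall s : R, dom omega s -> x s < sqrt 2)) /\
  (lambda = 0 ->
     omega = p_infty /\
     asymptotic_to_vertical_line x z (sqrt 2) /\
     (forall s t : R, 0 <= s -> s < t -> z s < z t) /\
     is_lim z p_infty p_infty) /\
  (-1 < lambda < 0 ->
     omega = p_infty /\
     entire_graph x z /\
     is_lim x p_infty p_infty /\
     is_lim z p_infty p_infty /\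
     is_lim theta p_infty (acos (- lambda))) /\
  convex_curve omega theta.
Proof.
  split; [ | split; [ | split]].
  - now apply positive_lambda_case with z.
  - intros ->.
    pose proof (lifetime_infinite _ _ _ _ _ H Hmax ltac:(lra)) as ->.
    pose proof (z_limit _ _ _ _ H ltac:(lra)) as Hz.
    repeat split; trivial.
    + now apply (zero_lambda_asymptote x z theta).
    + apply is_lim_le_p_loc with (2 := Hz); exists 0; intros s _; apply Rle_abs.
    + intros s t Hs Hst; now apply (z_increasing _ _ _ _ _ H).
  - intros Hl.
    pose proof (lifetime_infinite _ _ _ _ _ H Hmax ltac:(lra)) as ->.
    repeat split.
    + apply negative_lambda_graph with lambda theta; [exact H | lra].
    + apply negative_lambda_x_limit with lambda z theta; [exact H | lra].
    + apply z_limit with lambda x theta; [exact H | lra].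
    + apply negative_lambda_theta_limit with x z; [exact H | lra].
  - destruct (upward_convex _ _ _ _ _ H) as [kappa Hkappa].
    exists kappa; split; [ | left]; intros s Hs; now apply Hkappa.
Qed.

Lemma C1_on_opp (D : R -> Prop) (f : R -> R) : C1_on D f -> C1_on D (fun s => - f s).
Proof.
  intros [d Hd]; exists (fun s => - d s); intros s Hs; destruct (Hd s Hs) as [H1 H2]; split.
  - now apply (Dopp D).
  - now apply (limit_Ropp d (D_x D s)).
Qed.

Lemma solution_reflect lambda omega x z theta :
  is_solution lambda omega x z theta ->
  is_solution lambda omega x (fun s => - z s) (fun s => - theta s).
Proof.
  intros [C1 C2 C3 I1 I2 I3 Px Ps D1 D2 D3]; split; trivial.
  - now apply C1_on_opp.
  - now apply C1_on_opp.
  - rewrite I2; ring.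
  - rewrite I3; ring.
  - intros s Hs Hso; rewrite sin_neg; apply Ropp_neq_0_compat; auto.
  - intros s Hs Hso; rewrite cos_neg; auto.
  - intros s Hs Hso; rewrite sin_neg; now apply (is_derive_opp z s (sin (theta s))), D2.
  - intros s Hs Hso; rewrite sin_neg, cos_neg.
    replace (x s * (cos (theta s) / - sin (theta s)) + lambda * (x s / - sin (theta s)))
      with (- (x s * (cos (theta s) / sin (theta s)) + lambda * (x s / sin (theta s))))
      by (field; now apply Ps).
    now apply (is_derive_opp theta s (x s * (cos (theta s) / sin (theta s))
      + lambda * (x s / sin (theta s)))), D3.
Qed.

Lemma extendable_reflect lambda omega x z theta :
  extendable lambda omega x (fun s => - z s) (fun s => - theta s) ->
  extendable lambda omega x z theta.
Proof.
  intros [o' [x' [z' [t' [Ho [Hs He]]]]]].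
  exists o', x', (fun s => - z' s), (fun s => - t' s).
  split; [exact Ho | split; [now apply solution_reflect | ]].
  intros s Hd; destruct (He s Hd) as [H1 [H2 H3]]; repeat split; lra.
Qed.

Theorem theorem4p1 (lambda : R) (omega : Rbar) (x z theta : R -> R)
    (Hlambda : -1 < lambda)
    (Htranslator :
       lambda_translator lambda (mk3 0 0 1)
         (fun s t => 0 < s /\ Rbar_lt s omega)
         (rotational_surface x z))
    (Hsol : is_maximal_solution lambda omega x z theta) :
  up_to_reflection
    (fun z theta =>
       (0 < lambda ->
          exists w : R, omega = Finite w /\
            meets_z_axis_at x w /\
            ~ orthogonal_at theta w /\
            (forall s : R, dom omega s -> x s < sqrt 2)) /\
       (lambda = 0 ->
          omega = p_infty /\
          asymptotic_to_vertical_line x z (sqrt 2) /\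
          (forall s t : R, 0 <= s -> s < t -> z s < z t) /\
          is_lim z p_infty p_infty) /\
       (-1 < lambda < 0 ->
          omega = p_infty /\
          entire_graph x z /\
          is_lim x p_infty p_infty /\
          is_lim z p_infty p_infty /\
          is_lim theta p_infty (acos (- lambda))) /\
       convex_curve omega theta)
    z theta.
Proof.
  destruct Hsol as [Homega [Hs Hmax]].
  destruct (Rbar_lt_dense 0 omega Homega) as [a [Ha Hao]].
  pose proof (sol_sin_neq0 _ _ _ _ _ Hs) as Hsin.
  assert (Hcont : forall s, 0 < s -> Rbar_lt s omega -> continuous (fun s => sin (theta s)) s).
  { intros s Hs0 Hso; apply (continuous_comp theta sin); [ | apply continuous_sin].
    apply (ex_derive_continuous theta); eexists; now apply (sol_theta _ _ _ _ _ Hs). }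
  (* The sign of [sin theta] at one point decides whether to reflect. *)
  destruct (Rtotal_order (sin (theta a)) 0) as [Hneg | [Hz | Hpos]].
  - right; apply upward_classification.
    + split; trivial; [now apply solution_reflect | ].
      apply (nonvanishing_constant_sign (fun s => sin (- theta s)) omega) with (a := a); trivial.
      * intros s Hs0 Hso.
        apply (continuous_ext (fun s => - sin (theta s))); [intros; now rewrite sin_neg | ].
        now apply (continuous_opp (fun s => sin (theta s))), Hcont.
      * intros s Hs0 Hso; rewrite sin_neg; apply Ropp_neq_0_compat; auto.
      * rewrite sin_neg; lra.
    + intros He; apply Hmax; now apply extendable_reflect.
  - now destruct (Hsin a Ha Hao).
  - left; apply upward_classification; [split; trivial | exact Hmax].
    now apply (nonvanishing_constant_sign (fun s => sin (theta s)) omega) with (a := a).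
Qed.
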